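(* Let $L:TQ\to\mathbb{R}$ be a Lagrangian that is Lipschitz continuous in both variables $(q,\dot q)$. Let $\Psi^{(r)}_h$ be the Taylor method of order $r$ for the Euler--Lagrange vector field of $L$, and let $\{(b_i,c_i)\}_{i=1}^m$ be a quadrature formula of order $s$. Then the associated Taylor discrete Lagrangian $L_d$, defined by $$L_d(q_0,q_1;h)=h\sum_{i=1}^m b_i\,L(q_{c_i},v_{c_i}),\qquad (q_{c_i},v_{c_i})=\Psi^{(r)}_{c_ih}(q_0,\tilde v_0),\qquad q_1=\pi_Q\circ\Psi^{(r+1)}_h(q_0,\tilde v_0),$$ has order of accuracy at least $\min(r+1,s)$, i.e. $$L_d(q_0,q_1;h)=L_d^E(q_0,q_1;h)+\mathcal{O}\big(h^{\min(r+1,s)+1}\big),$$ where $L_d^E$ is the exact discrete Lagrangian.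
   Context: Work in coordinates on the configuration space $Q$ (open subset of $\mathbb{R}^n$). The Euler--Lagrange equation of $L$ is assumed to be of the form $\ddot q=f(q,\dot q,t)$. $L$ and $f$ are assumed sufficiently smooth for the Taylor methods and the quadrature error estimate below to make sense, in particular so that exact solutions satisfy $q\in C^{r+2}([0,h])$. $\pi_Q:TQ\to Q$ is the canonical projection, and $\Phi_t:TQ\to TQ$ is the exact time-$t$ flow of the Euler--Lagrange equation. Taylor method: for an integer $\rho$, the Taylor method of order $\rho$ on $TQ$ is $$\Psi^{(\rho)}_t(q_0,v)=\Big(\sum_{k=0}^{\rho}\tfrac{t^k}{k!}q^{(k)}(0),\ \sum_{k=1}^{\rho+1}\tfrac{t^{k-1}}{(k-1)!}q^{(k)}(0)\Big),$$ where $q^{(k)}(0)$ are the time derivatives at $0$ of the Euler--Lagrange solution with initial data $(q_0,v)$, computed from $f$ and its prolongations (successive total time derivatives) at $(q_0,v)$. Exact discrete Lagrangian: $L_d^E(q_0,q_1;h)=\int_0^h L(q_{01}(t),\dot q_{01}(t))\,dt$, where $q_{01}$ solves the Euler--Lagrange equation on $(0,h)$ with $q_{01}(0)=q_0$, $q_{01}(h)=q_1$. The approximate initial velocity $\tilde v_0$ is the solution of $q_1=\pi_Q\circ\Psi^{(r+1)}_h(q_0,\tilde v_0)$. If a quadrature node is $c_i=1$, the given value $q_1$ may be used for $q_{c_i}$. Quadrature of order $s$: $\int_0^h g(t)\,dt=h\sum_{i=1}^m b_i g(c_ih)+\mathcal{O}(h^{s+1})$ for sufficiently smooth $g$, with $c_i\in[0,1]$.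 Asymptotics are as $h\to0$, with $q_1=\pi_Q\Phi_h(q_0,v_0)$ for given $(q_0,v_0)$, and $\tilde v_0$ the solution of the inverse problem near $v_0$. *)

(* Defs.v *)
From HB Require Import structures.
From mathcomp Require Import all_boot all_order all_algebra.
From mathcomp Require Import all_classical all_reals all_analysis.
Set Implicit Arguments.
Unset Strict Implicit.
Unset Printing Implicit Defensive.
Import Order.TTheory GRing.Theory Num.Theory.
Import numFieldNormedType.Exports.
Local Open Scope ring_scope.
Local Open Scope classical_set_scope.

(* [Ck k A f]: f is of class C^k on A; meant for open A only.  In finite
   dimension, iterating over all directional derivatives is the usual notion. *)
Fixpoint Ck (R : realType) (U W : normedModType R) (k : nat) (A : set U)
    (f : U -> W) {struct k} : Prop :=
  match k with
  | 0%N => forall x, A x -> {for x, continuous f}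
  | k'.+1 => (forall x, A x -> differentiable f x) /\
             (forall w : U, Ck k' A ('D_w f))
  end.

Section EulerLagrange.
Variables (R : realType) (n : nat).
Local Notation V := 'rV[R]_n.
Implicit Types (Q : set V) (L : V * V -> R) (f : V * V * R -> V) (q : R -> V).

Definition TQ Q : set (V * V) := Q `*` setT.

Definition tangent_lift q (t : R) : V * V := (q t, q^`() t).

(* d/dt (dL/dv_i (q, q')) = dL/dq_i (q, q') at time t, for every i. *)
Definition euler_lagrange L q (t : R) : Prop :=
  forall i : 'I_n,
    let momentum s := 'D_((0, delta_mx 0 i) : V * V) L (tangent_lift q s) in
    derivable momentum t 1 /\
    momentum^`() t = 'D_((delta_mx 0 i, 0) : V * V) L (tangent_lift q t).

Definition C2_curve Q (a b : R) q : Prop :=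
  Ck 2 (`]a, b[ : set R) q /\ (forall t, t \in `]a, b[%R -> Q (q t)).

Definition el_solution Q L (a b : R) q : Prop :=
  C2_curve Q a b q /\ (forall t, t \in `]a, b[%R -> euler_lagrange L q t).

Definition el_normal_form Q L f : Prop :=
  forall (a b : R) q, C2_curve Q a b q ->
    (forall t, t \in `]a, b[%R -> euler_lagrange L q t) <->
    (forall t, t \in `]a, b[%R -> q^`(2) t = f (tangent_lift q t, t)).

(* The flow may be local: [Phi t x] is only meaningful for small |t|,
   depending on x. *)
Definition el_flow Q L (Phi : R -> V * V -> V * V) : Prop :=
  forall x, TQ Q x ->
    let q t := (Phi t x).1 in
    Phi 0 x = x /\
    exists2 T : R, 0 < T &
      el_solution Q L (- T) T q /\
      (forall t, t \in `]-T, T[%R -> Phi t x = tangent_lift q t).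

(* dG/dt along q'' = f(q, q', t), i.e. dG/dq . v + dG/dv . f + dG/dt. *)
Definition total_derivative f (G : V * V * R -> V) : V * V * R -> V :=
  fun x => 'D_((x.1.2, f x, 1) : V * V * R) G x.

(* [el_jet f k (q, v, t)] is q^(k) in terms of (q, q', t) = (q, v, t). *)
Definition el_jet f (k : nat) : V * V * R -> V :=
  match k with
  | 0%N => fun x => x.1.1
  | 1%N => fun x => x.1.2
  | j.+2 => iter j (total_derivative f) f
  end.

Definition taylor_method f (rho : nat) (t : R) (x : V * V) : V * V :=
  (\sum_(0 <= k < rho.+1) (t ^+ k / k`!%:R) *: el_jet f k (x, 0),
   \sum_(1 <= k < rho.+2) (t ^+ k.-1 / (k.-1)`!%:R) *: el_jet f k (x, 0)).

(* In the next two definitions [bvp q0 q1 h] is the chosen solution on [0, h]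
   of the boundary value problem, and [vel q0 q1 h] the chosen solution of the
   inverse problem for the Taylor map; both problems are only locally uniquely
   solvable. *)
Definition bvp_solution Q L (q0 q1 : V) (h : R) q : Prop :=
  [/\ el_solution Q L 0 h q, {within `[0, h], continuous q},
      q 0 = q0 & q h = q1].

Definition exact_discrete_lagrangian L (bvp : V -> V -> R -> R -> V)
    (q0 q1 : V) (h : R) : R :=
  let q := bvp q0 q1 h in
  \int[lebesgue_measure]_(t in `[0, h]) L (tangent_lift q t).

Definition inverse_solution f (r : nat) (q0 q1 : V) (h : R) (v : V) : Prop :=
  q1 = (taylor_method f r.+1 h (q0, v)).1.

(* [use_q1] tells whether q1 replaces the Taylor value of q_{c_i} at the nodes
   c_i = 1. *)
Definition taylor_discrete_lagrangian L f (r m : nat) (b c : 'I_m -> R)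
    (use_q1 : bool) (vel : V -> V -> R -> V) (q0 q1 : V) (h : R) : R :=
  h * \sum_(i < m) b i *
    L (let x := taylor_method f r (c i * h) (q0, vel q0 q1 h) in
       (if use_q1 && (c i == 1) then q1 else x.1, x.2)).

End EulerLagrange.

Definition quadrature_order (R : realType) (m : nat) (b c : 'I_m -> R)
    (s : nat) : Prop :=
  (forall i, 0 <= c i <= 1) /\
  exists k : nat, forall g : R -> R, Ck k setT g ->
    (fun h : R => \int[lebesgue_measure]_(t in `[0, h]) g t
                  - h * \sum_(i < m) b i * g (c i * h))
      =O_ (0^'+) (fun h : R => h ^+ s.+1).

(* Main.v *)
Require Import Defs.
From HB Require Import structures.
From mathcomp Require Import all_boot all_order all_algebra.
From mathcomp Require Import all_classical all_reals all_analysis.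
From mathcomp Require Import measurable_realfun ring lra.
Import Order.TTheory GRing.Theory Num.Theory.
Import numFieldNormedType.Exports.
Set Implicit Arguments.
Unset Strict Implicit.
Local Open Scope ring_scope.
Local Open Scope classical_set_scope.

(** Let q be the flow curve through (q0, v0) and q1 = q(h).  The error of the
    Taylor discrete Lagrangian splits into a node error, the difference between
    L at the nodes and L along q weighted by the quadrature, and a quadrature
    error, the defect of the quadrature on the function g(t) = L(q(t), q'(t)).
    For this splitting to make sense the exact discrete Lagrangian, defined by a
    solution of the boundary value problem, must be the integral of g: for small
    h a solution with bounded velocity is the flow curve [bvp_is_flow].  Indeed
    the difference w of two solutions vanishes at both ends and satisfies
    |w''| <= K (|w| + |w'|), where K is a Lipschitz constant of f on a compact
    box; a bound B for |w'| then improves to B / 2 when h is small, and so on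
    for ever [short_bvp_zero].

    Node error.  Along a solution, the time derivative of G(q, q', t) is the
    value of the derivative of G along the field (v, f, 1).  Iterating, the
    functions [el_jet] are the derivatives of q, and Taylor's formula with
    remainder O(t^k) holds along the flow for every G of class C^k
    [taylor_along].  Comparing the Taylor map of order r+1 that defines the
    approximate velocity v with the Taylor expansion of q(h), whose error is
    O(h^(r+2)), and using that the jets are Lipschitz in the velocity, gives
    h |v - v0| <= C h^(r+2) + C' h^2 |v - v0|, so |v - v0| = O(h^(r+1))
    [velocity_error].  Hence positions and velocities at the nodes are exact up
    to O(h^(r+1)) [node_error]; L being Lipschitz, the node error is h times
    O(h^(r+1)).

    Quadrature error.  The order of the quadrature is tested on functions of an
    unspecified class C^k, which may be higher than that of g.  Polynomials
    belong to all these classes, so the order is used for the Taylor polynomial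
    p of g of degree less than s; both the integral and the quadrature of g - p
    are O(h^(s+1)) since g - p = O(t^s) [quadrature_estimate].

    All the bounds on derivatives turn into bounds on increments by the mean
    value inequality [mean_value_le], and finite dimension enters through
    coordinates only [has_frame]: they make the derivative of a C^(k+1) function
    along a C^k field a C^k function [Ck_lie], and C^1 functions Lipschitz on
    compact convex sets [C1_lipschitz]. *)

(** * The mean value inequality *)

Section MeanValue.
Variables (R : realType) (W : normedModType R).

Lemma near_growth_le (u : R -> W) (t C : R) :
  derivable u t 1 -> `|'D_1 u t| < C ->
  exists2 d : R, 0 < d &
    forall s, `|s - t| < d -> `|u s - u t| <= C * `|s - t|.
Proof.
move=> du uC.
have /cvgrPdist_lt/(_ (C - `|'D_1 u t|)) := du.
rewrite subr_gt0 => /(_ uC)[d /= d0 H]; exists d => // s std.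
have [->|st] := eqVneq s t; first by rewrite !subrr !normr0 mulr0.
have st0 : s - t != 0 by rewrite subr_eq0.
move/(_ (s - t)) : H; rewrite /= sub0r normrN => /(_ std st0).
rewrite -[_%:A]/((s - t) * 1) mulr1 subrK => H.
rewrite mulrC -ler_pdivrMl ?normr_gt0// -normfV -normrZ.
rewrite -(subrK ('D_1 u t) (_ *: _)) (le_trans (ler_normD _ _))//.
by rewrite -lerBrDr distrC ltW.
Qed.

(** The function psi(t) = |u(t) - u(a)| - C' (t - a), with C' > C, decreases
    strictly to the left of each interior point, so on [a, b'], b' < b, its
    maximum is attained at a, where it is 0. *)
Lemma mean_value_le (u : R -> W) (a b C : R) : a <= b ->
  {within `[a, b], continuous u} ->
  (forall t, t \in `]a, b[%R -> derivable u t 1 /\ `|'D_1 u t| <= C) ->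
  `|u b - u a| <= C * (b - a).
Proof.
rewrite le_eqVlt => /predU1P[->|ab] cu du; first by rewrite !subrr normr0 mulr0.
apply/ler_addgt0Pr => e e0.
pose C' := C + e / (b - a).
have -> : C * (b - a) + e = C' * (b - a).
  by rewrite mulrDl divfK// subr_eq0 gt_eqF.
have C'C : C < C' by rewrite ltrDl divr_gt0// subr_gt0.
pose C'' := (C + C') / 2.
have [CC'' C''C'] : C < C'' /\ C'' < C' by rewrite /C''; clearbody C'; lra.
pose psi t := `|u t - u a| - C' * (t - a).
have psia : psi a = 0 by rewrite /psi !subrr normr0 mulr0 subr0.
have cpsi : {within `[a, b], continuous psi}.
  move=> x; apply: cvgB; last first.
    have : continuous (fun t => C' * (t - a)).
      move=> z; apply: cvgM; first exact: cvg_cst.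
      by apply: cvgB; [exact: cvg_id|exact: cvg_cst].
    by move/(@continuous_subspaceT _ _ `[a, b]); apply.
  by apply: cvg_norm; apply: cvgB; [exact: cu|exact: cvg_cst].
(* an interior point is never a maximum: psi is larger just before it *)
have dec c x : c \in `]a, b[%R -> x < c ->
    exists2 s, x < s < c & psi c < psi s.
  move=> cab xc; have [duc ducC] := du _ cab.
  have [d d0 H] := near_growth_le duc (le_lt_trans ducC CC'').
  have [_ cb] : a < c /\ c < b by move: cab; rewrite in_itv /= => /andP.
  pose e' := Num.min ((c - x) / 2) (d / 2).
  have e'0 : 0 < e' by rewrite lt_min !divr_gt0// subr_gt0.
  have e'x : e' < c - x by rewrite gt_min ltr_pdivrMr// ltr_pMr ?subr_gt0// ltr1n.
  have e'd : e' < d by rewrite gt_min orbC ltr_pdivrMr// ltr_pMr// ltr1n.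
  have psid : psi c - psi (c - e') <= (C'' - C') * e'.
    have := H (c - e'); rewrite addrAC subrr add0r normrN gtr0_norm// => /(_ e'd).
    rewrite distrC => H'; rewrite /psi.
    have := ler_normD (u c - u (c - e')) (u (c - e') - u a).
    rewrite addrA subrK => ?; lra.
  exists (c - e'); first by apply/andP; split; lra.
  by rewrite -subr_lt0 (le_lt_trans psid)// pmulr_llt0// subr_lt0.
have max_a b' : a <= b' -> b' < b -> psi b' <= 0.
  move=> ab' b'b.
  have [|c] := @EVT_max _ psi a b' ab'.
    by apply: continuous_subspaceW cpsi; apply: subset_itvl; rewrite bnd_simp ltW.
  rewrite in_itv/= => /andP[ac cb'] cmax.
  have [ca|ac'] := eqVneq c a; first by rewrite -psia -ca cmax// in_itv/= ab' lexx.
  have {}ac : a < c by rewrite lt_neqAle eq_sym ac'.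
  have [|s /andP[as_ sc]] := dec c a _ ac.
    by rewrite in_itv/= ac (le_lt_trans cb' b'b).
  rewrite ltNge cmax// in_itv/= ltW//= (le_trans (ltW sc))//.
suff : psi b <= 0 by rewrite /psi subr_le0.
have [_ _ cb] := (continuous_within_itvP psi ab).1 cpsi.
apply: (cvgr_to_le cb); near=> s.
apply: max_a.
- by near: s; exact: nbhs_left_ge.
- by near: s; exact: nbhs_left_lt.
Unshelve. all: by end_near. Qed.

End MeanValue.

(** * Maps of class C^k *)

Section ScaleDiff.
Variables (R : realType) (W : normedModType R).

Let scale_is_bilinear :
  bilinear_for
    (GRing.Scale.Law.clone _ _ *:%R _) (GRing.Scale.Law.clone _ _ *:%R _)
    (@GRing.scale R W : R -> W -> W).
Proof.
split=> [u'|u] a x y /=.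
- by rewrite scalerDl scalerA.
- by rewrite scalerDr !scalerA mulrC.
Qed.
Let scaleB : {bilinear R -> W -> W} :=
  HB.pack (@GRing.scale R W : R -> W -> W)
    (bilinear_isBilinear.Build R R W W _ _ (@GRing.scale R W) scale_is_bilinear).

Lemma is_diff_scale (U : normedModType R) (c : U -> R) (f : U -> W) x :
  differentiable c x -> differentiable f x ->
  is_diff x (fun y => c y *: f y) (fun y => c x *: 'd f x y + 'd c x y *: f x).
Proof.
move=> dc df.
have cB : continuous (fun p : R * W => scaleB p.1 p.2).
  by move=> p; exact: scale_continuous.
have dB := differentiable_bilin (c x, f x) cB.
have dp := differentiable_pair dc df.
have E : (fun y => c y *: f y) =
   (fun p : R * W => scaleB p.1 p.2) \o (fun y => (c y, f y)) by [].
rewrite E; apply: DiffDef; first exact: differentiable_comp.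
by rewrite diff_comp// diff_bilin// diff_pair.
Qed.
End ScaleDiff.

Section CkTheory.
Variables (R : realType) (U : normedModType R).
Implicit Types (A : set U).

Lemma CkW (W : normedModType R) k A (f : U -> W) : Ck k.+1 A f -> Ck k A f.
Proof.
elim: k f => [f [df _] x Ax|k IH f [df Df]].
  exact: differentiable_continuous (df x Ax).
by split=> // w; exact/IH/Df.
Qed.

Lemma Ck_le (W : normedModType R) j k A (f : U -> W) :
  (j <= k)%N -> Ck k A f -> Ck j A f.
Proof.
by move=> /subnKC <-; elim: (k - j)%N => [|i IH]; rewrite ?addn0// addnS => /CkW.
Qed.

Lemma Ck_continuous (W : normedModType R) k A (f : U -> W) x :
  Ck k A f -> A x -> {for x, continuous f}.
Proof. by move=> /(Ck_le (leq0n k)); exact. Qed.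

(** Differentiability at a point is local, so the class C^k of a map on an open
    set depends on its values on this set only [eq_Ck]. *)
Lemma near_eq_differentiable (W : normedModType R) (f g : U -> W) x :
  {near x, f =1 g} -> differentiable f x -> differentiable g x.
Proof.
move=> nfg df; have fgx := nbhs_singleton nfg.
have Eg : g \o shift x = cst (g x) + 'd f x +o_ 0 id.
  have /eqaddoP Ef := diff_locally df.
  have nfg0 : \forall y \near 0, f (y + x) = g (y + x).
    by have := nfg; rewrite [X in X -> _](near_shift 0) subr0.
  apply/eqaddoP => e e0; have := Ef e e0; apply: filterS2 nfg0 => y fgy.
  by rewrite /cst /= /GRing.add /= /GRing.opp /= /GRing.add /= fgy fgx.
have cdf := diff_continuous df.
apply/diff_locallyP; split; last by rewrite (diff_unique cdf Eg).
by rewrite (diff_unique cdf Eg).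
Qed.

Lemma eq_Ck (W : normedModType R) k A (f g : U -> W) :
  open A -> (forall x, A x -> f x = g x) -> Ck k A f -> Ck k A g.
Proof.
move=> oA; elim: k f g => [|k IH] f g fg.
  move=> cf x Ax; have nfg : \forall y \near x, f y = g y.
    by apply: filterS (open_nbhs_nbhs (conj oA Ax)) => y /fg.
  have cfx : f @ x --> g x by rewrite -fg//; exact: cf.
  by apply: cvg_trans cfx; exact: near_eq_cvg nfg.
have nfg x : A x -> {near x, f =1 g}.
  by move=> Ax; apply: filterS (open_nbhs_nbhs (conj oA Ax)) => y /fg.
move=> [df Df]; split=> [x Ax|w].
  exact: near_eq_differentiable (nfg x Ax) (df x Ax).
by apply: IH (Df w) => x Ax; exact: near_eq_derive (nfg x Ax).
Qed.

Lemma Ck_cst (W : normedModType R) k A (a : W) : Ck k A (fun=> a).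
Proof.
elim: k a => [|k IH] a /=; first by move=> x _; exact: cst_continuous.
split=> [x _|w]; first exact: differentiable_cst.
rewrite (_ : 'D_w _ = fun=> 0); first exact: IH.
by apply/funext => x; exact: derive_cst.
Qed.

Lemma CkD (W : normedModType R) k A (f g : U -> W) : open A ->
  Ck k A f -> Ck k A g -> Ck k A (fun x => f x + g x).
Proof.
move=> oA; elim: k f g => [|k IH] f g.
  by move=> cf cg x Ax; apply: continuousD; [exact: cf|exact: cg].
move=> [df Df] [dg Dg]; split=> [x Ax|w].
  by apply: differentiableD; [exact: df|exact: dg].
apply: eq_Ck (IH _ _ (Df w) (Dg w)) => // x Ax.
by rewrite deriveD//; apply: diff_derivable; [exact: df|exact: dg].
Qed.

Lemma Ck_sum (W : normedModType R) (I : finType) k A (F : I -> U -> W) :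
  open A -> (forall i, Ck k A (F i)) -> Ck k A (fun x => \sum_i F i x).
Proof.
move=> oA CF.
suff H (r : seq I) : Ck k A (fun x => \sum_(i <- r) F i x) by exact: H.
elim: r => [|i r IH].
  by apply: eq_Ck (Ck_cst k A 0) => // x _; rewrite big_nil.
by apply: eq_Ck (CkD oA (CF i) IH) => // x _; rewrite big_cons.
Qed.

Lemma CkZ (W : normedModType R) k A (c : U -> R) (f : U -> W) : open A ->
  Ck k A c -> Ck k A f -> Ck k A (fun x => c x *: f x).
Proof.
move=> oA; elim: k c f => [|k IH] c f.
  by move=> cc cf x Ax; apply: continuousZ; [exact: cc|exact: cf].
move=> Cc Cf.
have [dc Dc] := Cc; have [df Df] := Cf; split=> [x Ax|w].
  by have [] := is_diff_scale (dc x Ax) (df x Ax).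
apply: eq_Ck (CkD oA (IH _ _ (CkW Cc) (Df w)) (IH _ _ (Dc w) (CkW Cf))) => // x Ax.
have [dcx dfx] := (dc x Ax, df x Ax).
have [dcf dcfE] := is_diff_scale dcx dfx.
by rewrite (deriveE _ dcf) dcfE (deriveE _ dcx) (deriveE _ dfx).
Qed.

Lemma Ck_linear_comp (W W' : normedModType R) (l : {linear W -> W'}) k A
    (f : U -> W) : open A -> continuous l -> Ck k A f -> Ck k A (l \o f).
Proof.
move=> oA cl; elim: k f => [|k IH] f.
  by move=> cf x Ax; apply: continuous_comp; [exact: cf|exact: cl].
move=> [df Df].
have dl y : differentiable l y by exact: linear_differentiable.
split=> [x Ax|w].
  by apply: differentiable_comp; [exact: df|].
apply: eq_Ck (IH _ (Df w)) => // x Ax.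
have dfx := df x Ax.
rewrite deriveE; last exact: differentiable_comp.
by rewrite diff_comp//= diff_lin// deriveE.
Qed.

Lemma Ck_linear (W : normedModType R) (l : {linear U -> W}) k A :
  open A -> continuous l -> Ck k A l.
Proof.
move=> oA cl; suff : Ck k A (@idfun U) by exact: Ck_linear_comp.
case: k => [|k]; first by move=> x _.
split=> [x _|w]; first by [].
by rewrite (_ : 'D_w _ = fun=> w); [exact: Ck_cst|apply/funext => x; exact: derive_id].
Qed.

End CkTheory.

Section CkProducts.
Variables (R : realType) (U V W : normedModType R).

Lemma derive_pair (f : U -> V) (g : U -> W) (x w : U) :
  differentiable f x -> differentiable g x ->
  'D_w (fun y => (f y, g y)) x = ('D_w f x, 'D_w g x).
Proof.
move=> df dg; have dfg := differentiable_pair df dg.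
by rewrite (deriveE _ dfg) diff_pair// !deriveE.
Qed.

Lemma Ck_pair k (A : set U) (f : U -> V) (g : U -> W) : open A ->
  Ck k A f -> Ck k A g -> Ck k A (fun x => (f x, g x)).
Proof.
move=> oA; elim: k f g => [|k IH] f g.
  by move=> cf cg x Ax; apply: cvg_pair; [exact: cf|exact: cg].
move=> [df Df] [dg Dg]; split=> [x Ax|w].
  by apply: differentiable_pair; [exact: df|exact: dg].
apply: eq_Ck (IH _ _ (Df w) (Dg w)) => // x Ax.
by rewrite derive_pair//; [exact: df|exact: dg].
Qed.

Lemma Ck_fst k (A : set U) (G : U -> W) :
  Ck k A G -> Ck k (A `*` setT) (fun x : U * V => G x.1).
Proof.
have cfst : continuous (@fst U V) by move=> x; exact: cvg_fst.
pose lfst : {linear (U * V)%type -> U} := @fst U V.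
have dfst x : differentiable lfst x by apply: (linear_differentiable (f := lfst)) => z; exact: cfst.
elim: k G => [|k IH] G.
  move=> cG x [Ax _]; apply: (@continuous_comp _ _ _ fst G); first exact: cfst.
  exact: cG.
move=> [dG DG]; split=> [x [Ax _]|w].
  by apply: (@differentiable_comp _ _ _ _ lfst G) => //; exact: dG.
exact: IH ('D_(w.1) G) (DG w.1).
Qed.

Lemma open_cylinder (A : set U) : open A -> open (A `*` (setT : set V)).
Proof.
move=> oA; have -> : A `*` (setT : set V) = fst @^-1` A.
  by apply/seteqP; split=> [x []|x Ax] //; split.
by apply: open_comp => // x _; exact: cvg_fst.
Qed.
End CkProducts.

(** * Coordinates *)

(** Finite dimension, in the form in which it is used: a finite family spanning
    the space together with continuous coordinate forms. *)
Definition has_frame (R : realType) (U : normedModType R) :=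
  exists (I : finType) (e : I -> U) (c : I -> {linear U -> R}),
    (forall i, continuous (c i)) /\ forall x, x = \sum_i c i x *: e i.

Lemma has_frame_rV (R : realType) n : has_frame ('rV[R]_n : normedModType R).
Proof.
pose c (j : 'I_n) (x : 'rV[R]_n) : R := x 0 j.
have cl j : linear (c j) by move=> a x y; rewrite /c !mxE.
pose cL j : {linear 'rV[R]_n -> R} :=
  HB.pack (c j) (GRing.isLinear.Build _ _ _ _ _ (cl j)).
exists 'I_n, (delta_mx 0), cL; split; first by move=> j x; exact: coord_continuous.
by move=> x; exact: row_sum_delta.
Qed.

Lemma has_frame_R (R : realType) : has_frame (R : normedModType R).
Proof.
exists unit, (fun=> 1), (fun=> idfun); split; first by move=> _ x; exact: cvg_id.
by move=> x; rewrite (big_pred1 tt)//= ?[_%:A]mulr1//; case.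
Qed.

Lemma has_frame_prod (R : realType) (U V : normedModType R) :
  has_frame U -> has_frame V -> has_frame (U * V)%type.
Proof.
move=> [I [e [c [cc cE]]]] [J [e' [c' [cc' cE']]]].
exists (I + J)%type.
exists (fun k => match k with inl i => (e i, 0) | inr j => (0, e' j) end).
pose d k (x : U * V) : R := match k with inl i => c i x.1 | inr j => c' j x.2 end.
have dl k : linear (d k).
  by case: k => i a x y; rewrite /d /= linearP.
pose dL k : {linear (U * V)%type -> R} :=
  HB.pack (d k) (GRing.isLinear.Build _ _ _ _ _ (dl k)).
exists dL; split.
  case=> i x; rewrite /dL /=.
    by apply: continuous_comp; [exact: cvg_fst|exact: cc].
  by apply: continuous_comp; [exact: cvg_snd|exact: cc'].
move=> [x y]; rewrite big_sumType /= /d /=.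
have -> : \sum_i c i x *: (e i, 0) = (x, 0) :> U * V.
  rewrite {2}[x]cE; elim/big_ind2 : _ => // [p u q v -> ->|i _].
    by rewrite -[LHS]/(_ + _, _ + _) addr0.
  by rewrite -[LHS]/(_ *: _, _ *: _) scaler0.
have -> : \sum_i c' i y *: (0, e' i) = (0, y) :> U * V.
  rewrite {2}[y]cE'; elim/big_ind2 : _ => // [p u q v -> ->|i _].
    by rewrite -[LHS]/(_ + _, _ + _) addr0.
  by rewrite -[LHS]/(_ *: _, _ *: _) scaler0.
by rewrite -[RHS]/(_ + _, _ + _) addr0 add0r.
Qed.

Section Frame.
Variables (R : realType) (U W : normedModType R).

Lemma derive_frame (I : finType) (e : I -> U) (c : I -> {linear U -> R})
    (G : U -> W) x w : (forall x, x = \sum_i c i x *: e i) ->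
  differentiable G x -> 'D_w G x = \sum_i c i w *: 'D_(e i) G x.
Proof.
move=> cE dG; rewrite deriveE// {1}[w]cE linear_sum; apply: eq_bigr => i _.
by rewrite linearZ /= deriveE.
Qed.

(** In coordinates, the derivative of G along X is the sum of the c_i(X(x))
    times the directional derivatives of G along the constant vectors e_i, and
    these are C^k by definition. *)
Lemma Ck_lie k (A : set U) (X : U -> U) (G : U -> W) :
  has_frame U -> open A -> Ck k A X -> Ck k.+1 A G ->
  Ck k A (fun x => 'D_(X x) G x).
Proof.
move=> [I [e [c [cc cE]]]] oA CX [dG DG].
apply: (eq_Ck (f := fun x => \sum_i c i (X x) *: 'D_(e i) G x)) => //.
  by move=> x Ax; rewrite -derive_frame//; exact: dG.
apply: Ck_sum => // i; apply: CkZ => //; last exact: DG.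
by apply: (Ck_linear_comp (l := c i)).
Qed.

(** The finitely many directional derivatives along the frame are continuous,
    hence bounded on K; the mean value inequality is then applied on segments. *)
Lemma C1_lipschitz (A K : set U) (G : U -> W) :
  has_frame U -> Ck 1 A G -> compact K -> K `<=` A ->
  (forall x y t, K x -> K y -> 0 <= t <= 1 -> K (x + t *: (y - x))) ->
  exists2 C, 0 <= C & forall x y, K x -> K y -> `|G y - G x| <= C * `|y - x|.
Proof.
move=> [I [e [c [cc cE]]]] [dG DG] cK KA convK.
have [k kP] : {k : I -> R & forall i, 0 < k i /\ forall x, `|c i x| <= k i * `|x|}.
  apply: (@choice I R (fun i k => 0 < k /\ forall x, `|c i x| <= k * `|x|)) => i.
  by have [k k0 kP] := linear_lipschitz (cc i); exists k.
have [M MP] : {M : I -> R &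
    forall i, 0 < M i /\ forall x, K x -> `|'D_(e i) G x| <= M i}.
  apply: (@choice I R
    (fun i M => 0 < M /\ forall x, K x -> `|'D_(e i) G x| <= M)) => i.
  have cD : {within K, continuous ('D_(e i) G)}.
    apply: continuous_in_subspaceT => x /set_mem Kx; exact/DG/KA.
  have /compact_bounded/ex_strict_bound_gt0[M M0 MP] :=
    continuous_compact cD cK.
  by exists M; split=> // x Kx; apply/ltW/MP; exists x.
exists (\sum_i k i * M i).
  by apply: sumr_ge0 => i _; rewrite mulr_ge0// ltW//; [case: (kP i)|case: (MP i)].
move=> x y Kx Ky.
have DGle z w : K z -> `|'D_w G z| <= (\sum_i k i * M i) * `|w|.
  move=> Kz; rewrite (derive_frame _ cE (dG _ (KA _ Kz))) mulr_suml.
  rewrite (le_trans (ler_norm_sum _ _ _))//; apply: ler_sum => i _.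
  rewrite normrZ mulrAC ler_pM//; first by case: (kP i).
  by case: (MP i) => _; exact.
pose u (t : R) := G (x + t *: (y - x)).
have -> : G y = u 1 by rewrite /u scale1r addrC subrK.
have -> : G x = u 0 by rewrite /u scale0r addr0.
rewrite -[leRHS]mulr1 -[X in _ * X]subr0.
have du (t : R) : 0 <= t <= 1 -> differentiable u t /\ 'D_1 u t = 'D_(y - x) G (x + t *: (y - x)).
  move=> t01; have dGt := dG _ (KA _ (convK _ _ _ Kx Ky t01)).
  pose l (s : R) := x + s *: (y - x).
  have dl : is_diff t l (fun s => s *: (y - x)).
    have := is_diffD (is_diff_cst x t) (is_diff_scalel t (y - x)).
    by rewrite add0r.
  have duE : u = G \o l by [].
  have dut : differentiable u t by rewrite duE; apply: differentiable_comp.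
  split=> //; rewrite deriveE// duE diff_comp//= diff_val scale1r deriveE//.
apply: mean_value_le => //.
  apply: derivable_within_continuous => t; rewrite in_itv/= => t01.
  by apply/derivable1_diffP; have [] := du t t01.
move=> t; rewrite in_itv/= => /andP[t0 t1].
have t01 : 0 <= t <= 1 by rewrite !ltW.
have [dut ->] := du _ t01; split; first exact/derivable1_diffP.
by apply: DGle; exact: convK.
Qed.

End Frame.

(** * Taylor's formula along an integral curve *)

Section TaylorSum.
Variables (R : realType) (W : normedModType R).

Definition taylor_sum (k : nat) (a : nat -> W) (t : R) : W :=
  \sum_(0 <= j < k) (t ^+ j / j`!%:R) *: a j.

Lemma is_derive_taylor_monomial (j : nat) (a : W) (t : R) :
  is_derive t 1 (fun s : R => (s ^+ j.+1 / (j.+1)`!%:R) *: a)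
    ((t ^+ j / j`!%:R) *: a).
Proof.
pose c (s : R) := s ^+ j.+1 / (j.+1)`!%:R.
have cE : c = (j.+1)`!%:R^-1 *: (fun s : R => s ^+ j.+1).
  by apply/funext => s; rewrite /c mulrC.
have dc : derivable c t 1.
  by rewrite cE; apply: derivableZ; exact: exprn_derivable.
have c't : 'D_1 c t = t ^+ j / j`!%:R.
  rewrite cE deriveZ; last exact: exprn_derivable.
  rewrite exp_derive [_%:A]mulr1 /= -[LHS]/(_ * (_ * _)) factS natrM.
  have j0 : j.+1%:R != 0 :> R by rewrite pnatr_eq0.
  have f0 : j`!%:R != 0 :> R by rewrite pnatr_eq0 -lt0n fact_gt0.
  by field; rewrite f0 nat1r j0.
have /derivable1_diffP dcd := dc.
have dacst : differentiable (fun _ : R => a) t by exact: differentiable_cst.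
have [dca dcaE] := is_diff_scale dcd dacst.
apply: DeriveDef; first exact/derivable1_diffP.
rewrite deriveE// dcaE diff_cst /= scaler0 add0r -deriveE//.
by congr (_ *: _).
Qed.

Lemma taylor_sum0 k a : taylor_sum k.+1 a 0 = a 0%N.
Proof.
rewrite /taylor_sum big_nat_recl// expr0 divr1 scale1r big1 ?addr0// => j _.
by rewrite expr0n/= mul0r scale0r.
Qed.

(** Differentiating a Taylor sum shifts its coefficients, which is what makes
    the induction of Taylor's formula work. *)
Lemma is_derive_taylor_sum k a (t : R) :
  is_derive t 1 (taylor_sum k.+1 a) (taylor_sum k (fun j => a j.+1) t).
Proof.
elim: k => [|k IH].
  rewrite (_ : taylor_sum _ _ = fun=> a 0%N).
    by rewrite /taylor_sum big_geq//; exact: is_derive_cst.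
  by apply/funext => s; rewrite /taylor_sum big_nat1 expr0 divr1 scale1r.
rewrite (_ : taylor_sum k.+2 a = taylor_sum k.+1 a +
    (fun s => (s ^+ k.+1 / (k.+1)`!%:R) *: a k.+1)).
  rewrite {2}/taylor_sum big_nat_recr//=.
  by apply: is_deriveD; exact: is_derive_taylor_monomial.
by apply/funext => s; rewrite {1}/taylor_sum big_nat_recr.
Qed.
End TaylorSum.

Section TaylorFlow.
Variables (R : realType) (U : normedModType R) (A : set U) (X : U -> U).
Hypotheses (frameU : has_frame U) (oA : open A).

Definition lie (W : normedModType R) (G : U -> W) : U -> W :=
  fun x => 'D_(X x) G x.

(** Each derivative along X costs one degree of smoothness. *)
Lemma Ck_iter_lie (W : normedModType R) j p (G : U -> W) :
  Ck (j + p) A X -> Ck (j + p) A G -> Ck p A (iter j (@lie W) G).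
Proof.
elim: j p => [|j IH] p; first by rewrite add0n.
rewrite addSnnS => CX CG; rewrite iterS.
apply: Ck_lie => //; last exact: IH.
by apply: Ck_le CX; rewrite addnS -addSn leq_addl.
Qed.

Variables (y : R -> U) (T : R).
Hypothesis T0 : 0 < T.
Hypothesis yA : forall t, t \in `]-T, T[%R -> A (y t).
Hypothesis dy : forall t, t \in `]-T, T[%R -> is_derive t 1 y (X (y t)).

Lemma is_derive_along (W : normedModType R) (G : U -> W) t :
  t \in `]-T, T[%R -> differentiable G (y t) ->
  is_derive t 1 (G \o y) (lie G (y t)).
Proof.
move=> tT dG; have [yt y't] := dy tT.
have /derivable1_diffP dyt := yt.
have dGy : differentiable (G \o y) t by exact: differentiable_comp.
apply: DeriveDef; first exact/derivable1_diffP.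
by rewrite deriveE// diff_comp//= -(deriveE _ dyt) y't /lie deriveE.
Qed.

(** Taylor's formula along an integral curve y of X, by induction on k: the
    remainder of order k+1 of G vanishes at 0, and its derivative is the
    remainder of order k of the derivative of G along X. *)
Lemma taylor_along (W : normedModType R) k (G : U -> W) :
  Ck k A X -> Ck k A G ->
  exists C : R, exists2 e : R, 0 < e < T & forall t, 0 <= t <= e ->
    `|G (y t) - taylor_sum k (fun j => iter j (@lie W) G (y 0)) t| <= C * t ^+ k.
Proof.
have zT : 0 \in `]-T, T[%R by rewrite in_itv/= oppr_lt0 T0.
elim: k G => [|k IH] G CX CG.
  have cGy : {for 0, continuous (G \o y)}.
    apply: continuous_comp; last exact/(Ck_continuous CG)/yA.
    have [/derivable1_diffP dy0 _] := dy zT.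
    exact: differentiable_continuous.
  have /cvgrPdist_lt/(_ 1 ltr01)[d /= d0 H] := cGy.
  exists (`|G (y 0)| + 1); exists (Num.min (d / 2) (T / 2)).
    by rewrite lt_min !divr_gt0//= gt_min orbC ltr_pdivrMr// ltr_pMr// ltr1n.
  move=> t /andP[t0]; rewrite le_min => /andP[td _].
  rewrite /taylor_sum big_geq// subr0 expr0 mulr1.
  have /H /= : `|0 - t| < d.
    rewrite sub0r normrN ger0_norm// (le_lt_trans td)//.
    by rewrite ltr_pdivrMr// ltr_pMr// ltr1n.
  move=> H1; rewrite -(subrK (G (y 0)) (G (y t))) addrC.
  by rewrite (le_trans (ler_normD _ _))// lerD// distrC ltW.
have [C [e /andP[e0 eT] H]] := IH (lie G) (CkW CX) (Ck_lie frameU oA (CkW CX) CG).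
exists C, e; first by rewrite e0.
move=> t /andP[t0 te].
pose a j := iter j (@lie W) G (y 0).
pose u := (G \o y) - taylor_sum k.+1 a.
have u0 : u 0 = 0.
  by rewrite /u /= -[LHS]/(_ - _) taylor_sum0 /= subrr.
have sT s : 0 <= s <= t -> s \in `]-T, T[%R.
  move=> /andP[s0 st]; rewrite in_itv/= (lt_le_trans _ s0) ?oppr_lt0//=.
  exact: le_lt_trans (le_trans st te) eT.
have du s : 0 <= s <= t -> is_derive s 1 u
    (lie G (y s) - taylor_sum k (fun j => a j.+1) s).
  move=> st; apply: is_deriveB; last exact: is_derive_taylor_sum.
  apply: is_derive_along; first exact: sT.
  by case: CG => dG _; exact/dG/yA/sT.
rewrite -[X in `|X|]/(u t) -[u t]subr0 -u0 exprSr mulrA -[X in _ * X]subr0.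
apply: mean_value_le => //.
  apply: derivable_within_continuous => s; rewrite in_itv/= => st.
  by have [] := du s st.
move=> s; rewrite in_itv/= => /andP[s0 st].
have s0t : 0 <= s <= t by rewrite !ltW.
have [us ->] := du s s0t; split=> //.
have := H s; rewrite ltW//= (le_trans (ltW st) te) => /(_ isT).
have -> : taylor_sum k (fun j => iter j (@lie W) (lie G) (y 0)) s =
          taylor_sum k (fun j => a j.+1) s.
  by apply: eq_bigr => j _; rewrite /a iterSr.
move=> Hs; apply: (le_trans Hs).
have C0 : 0 <= C by rewrite -(pmulr_lge0 _ (exprn_gt0 k s0)) (le_trans _ Hs).
by rewrite ler_wpM2l// lerXn2r// ?nnegrE ?ltW.
Qed.

End TaylorFlow.

(** * Quadrature of functions with a Taylor expansion at 0 *)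

Section Quadrature.
Variable R : realType.
Local Notation mu := (@lebesgue_measure R).

Lemma Ck_horner k (p : {poly R}) : Ck k setT (horner p).
Proof.
elim: k p => [|k IH] p; first by move=> x _; exact: continuous_horner.
split=> [x _|w]; first exact/derivable1_diffP/derivable_horner.
rewrite (_ : 'D_w _ = horner (w *: p^`())); first exact: IH.
apply/funext => x; have dp : differentiable (horner p) x.
  exact/derivable1_diffP/derivable_horner.
rewrite deriveE// -[w in LHS]mulr1 -[w * 1]/(w *: 1) linearZ /= -deriveE//.
by rewrite -derive1E -derivE hornerZ.
Qed.

Lemma taylor_sum_horner k (a : nat -> R) (t : R) :
  taylor_sum k a t = (\poly_(j < k) (a j / j`!%:R)).[t].
Proof.
rewrite horner_poly /taylor_sum big_mkord; apply: eq_bigr => j _.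
by rewrite -[LHS]/(_ * _) mulrAC [in RHS]mulrC mulrA.
Qed.

(** The derivative of a curve given on [a, b] only is meaningless at the end
    points; these do not contribute to the integral. *)
Lemma eq_Rintegral_oo (f g : R -> R) (a b : R) :
  {within `[a, b], continuous g} -> (forall t, t \in `]a, b[%R -> f t = g t) ->
  \int[mu]_(t in `[a, b]) f t = \int[mu]_(t in `[a, b]) g t.
Proof.
move=> cg fg.
have gi : mu.-integrable `[a, b] (EFin \o g).
  by apply: continuous_compact_integrable => //; exact: segment_compact.
have mg : measurable_fun `]a, b[ g.
  move: gi => /integrableP[/measurable_EFinP mg _]; apply: measurable_funS mg => //.
  by apply: subset_itv; rewrite bnd_simp.
have mf : measurable_fun `]a, b[ f.
  apply: eq_measurable_fun mg => t /set_mem; rewrite /= => tab.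
  by rewrite fg.
have drop_ends (u : R -> R) : measurable_fun `]a, b[ u ->
    (\int[mu]_(t in `[a, b]) (u t)%:E = \int[mu]_(t in `]a, b[) (u t)%:E)%E.
  by move=> mu_; rewrite integral_itv_bndoo//; exact/measurable_EFinP.
rewrite /Rintegral !drop_ends//.
by congr fine; apply: eq_integral => t /set_mem; rewrite /= => /fg ->.
Qed.

Lemma Rintegral_poly_approx_le (g : R -> R) (p : {poly R}) (h C : R) : 0 < h ->
  {within `[0, h], continuous g} ->
  (forall t, 0 <= t <= h -> `|g t - p.[t]| <= C) ->
  `|\int[mu]_(t in `[0, h]) g t - \int[mu]_(t in `[0, h]) p.[t]| <= C * h.
Proof.
move=> h0 cg gp.
have int (f : R -> R) : {within `[0, h], continuous f} ->
    mu.-integrable `[0, h] (EFin \o f).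
  by move=> cf; apply: continuous_compact_integrable => //; exact: segment_compact.
have cp : {within `[0, h], continuous (horner p)}.
  by apply: continuous_subspaceT; exact: continuous_horner.
have cgp : {within `[0, h], continuous (fun t => g t - p.[t])}.
  by move=> x; apply: cvgB; [exact: cg|exact: cp].
rewrite -RintegralB//; [|exact: int..].
rewrite (le_trans (le_normr_Rintegral _ _))//; first exact: int.
have -> : C * h = \int[mu]_(t in `[0, h]) C.
  by rewrite Rintegral_cst//= lebesgue_measure_itv/= lte_fin h0/= subr0.
apply: le_Rintegral => //.
- by apply: int => x; apply: cvg_norm; exact: cgp.
- by apply: int => x; exact: cvg_cst.
Qed.

(** Only a one-sided expansion g = p + O(t^s) is asked of g: the order of the
    quadrature is applied to the polynomial p, which belongs to every class C^k,
    and the integral and the quadrature sum of g - p are bounded directly. *)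
Lemma quadrature_estimate (m : nat) (b c : 'I_m -> R) (s : nat) (g : R -> R)
    (p : {poly R}) (e C : R) :
  quadrature_order b c s -> 0 < e -> {within `[0, e], continuous g} ->
  (forall t, 0 <= t <= e -> `|g t - p.[t]| <= C * t ^+ s) ->
  exists2 C' : R, 0 <= C' & \forall h \near 0^'+,
    `|h * (\sum_(i < m) b i * g (c i * h)) - \int[mu]_(t in `[0, h]) g t|
      <= C' * h ^+ s.+1.
Proof.
move=> [c01 [k Q]] e0 cg gp.
have C0 : 0 <= C.
  have := gp e; rewrite lexx ltW// => /(_ isT) ge.
  by rewrite -(pmulr_lge0 _ (exprn_gt0 s e0)) (le_trans _ ge).
have /eqO_exP [D D0 QD] := Q (horner p) (Ck_horner k p).
exists (D + C + (\sum_(i < m) `|b i|) * C).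
  by rewrite !addr_ge0 ?mulr_ge0 ?sumr_ge0// ltW.
near=> h.
have h0 : 0 < h by near: h; exact: nbhs_right_gt.
have he : h <= e by near: h; exact: nbhs_right_le.
have Qh : `|\int[mu]_(t in `[0, h]) p.[t] - h * \sum_(i < m) b i * p.[c i * h]|
    <= D * h ^+ s.+1.
  rewrite -[X in D * X]ger0_norm; last by rewrite exprn_ge0// ltW.
  by near: h.
have gp' t : 0 <= t <= h -> `|g t - p.[t]| <= C * h ^+ s.
  move=> /andP[t0 th]; apply: le_trans (gp t _) _; first by rewrite t0 (le_trans th).
  by rewrite ler_wpM2l// lerXn2r// ?nnegrE ?ltW// (le_lt_trans t0).
have Ih : `|\int[mu]_(t in `[0, h]) g t - \int[mu]_(t in `[0, h]) p.[t]|
    <= C * h ^+ s * h.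
  apply: Rintegral_poly_approx_le => //.
  by apply: continuous_subspaceW cg; apply: subset_itvl; rewrite bnd_simp.
have Sh : `|\sum_(i < m) b i * g (c i * h) - \sum_(i < m) b i * p.[c i * h]|
    <= (\sum_(i < m) `|b i|) * (C * h ^+ s).
  rewrite -sumrB mulr_suml (le_trans (ler_norm_sum _ _ _))//.
  apply: ler_sum => i _; rewrite -mulrBr normrM ler_wpM2l// gp'//.
  have /andP[ci0 ci1] := c01 i.
  by apply/andP; split; [rewrite mulr_ge0// ltW|rewrite ler_piMl// ltW].
move: Qh Ih Sh; set I1 := \int[mu]_(t in _) g t; set I2 := \int[mu]_(t in _) p.[t].
set S1 := \sum_(i < m) _ * g _; set S2 := \sum_(i < m) _ * p.[_].
move=> Qh Ih Sh.
have -> : h * S1 - I1 = h * (S1 - S2) - (I2 - h * S2) - (I1 - I2) by ring.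
rewrite (le_trans (ler_normB _ _))// (le_trans (lerD (ler_normB _ _) (lexx _)))//.
rewrite normrM gtr0_norm//.
apply: (@le_trans _ _ (h * ((\sum_(i < m) `|b i|) * (C * h ^+ s)) +
   D * h ^+ s.+1 + C * h ^+ s * h)).
  by rewrite !lerD// ler_wpM2l// ltW.
by rewrite exprS le_eqVlt; apply/orP; left; apply/eqP; ring.
Unshelve. all: by end_near. Qed.

End Quadrature.

(** * Uniqueness for two-point problems on short intervals *)

Section ShortBVP.
Variables (R : realType) (W : normedModType R).
Variables (w : R -> W) (h K : R).
Hypotheses (h0 : 0 < h) (K0 : 0 <= K) (hK : K * (1 + h) * h <= 1 / 2).
Hypotheses (cw : {within `[0, h], continuous w}) (w0 : w 0 = 0) (wh : w h = 0).
Hypothesis dw : forall t, t \in `]0, h[%R -> derivable w t 1.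
Hypothesis dw' : forall t, t \in `]0, h[%R -> derivable ('D_1 w) t 1 /\
  `|'D_1 ('D_1 w) t| <= K * (`|w t| + `|'D_1 w t|).

(** Since w vanishes at 0, a bound B on |w'| bounds |w| by B h, hence |w''| by
    K (1 + h) B; so w' oscillates by at most K (1 + h) B h <= B / 2.  As w also
    vanishes at h, its mean slope is 0, and |w'| itself is at most B / 2. *)
Let halve (B : R) : (forall t, t \in `]0, h[%R -> `|'D_1 w t| <= B) ->
  forall t, t \in `]0, h[%R -> `|'D_1 w t| <= B / 2.
Proof.
move=> wB.
have B0 : 0 <= B.
  apply: le_trans (wB (h / 2) _); first exact: normr_ge0.
  by rewrite in_itv/= divr_gt0//= ltr_pdivrMr// ltr_pMr// ltr1n.
have wle t : t \in `]0, h[%R -> `|w t| <= B * h.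
  move=> tI; have /andP[t0 th] : 0 < t < h by move: tI; rewrite in_itv.
  rewrite -[w t]subr0 -w0 (@le_trans _ _ (B * (t - 0)))//.
    apply: mean_value_le; first exact: ltW.
      by apply: continuous_subspaceW cw; apply: subset_itvl; rewrite bnd_simp ltW.
    move=> s; rewrite in_itv/= => /andP[s0 st].
    have sI : s \in `]0, h[%R by rewrite in_itv/= s0 (lt_trans st).
    by split; [exact: dw|exact: wB].
  by rewrite subr0 ler_wpM2l// ltW.
have w''le t : t \in `]0, h[%R -> `|'D_1 ('D_1 w) t| <= K * (1 + h) * B.
  move=> tI; have [_ /le_trans] := dw' tI; apply.
  by rewrite -mulrA ler_wpM2l// mulrDl mul1r addrC lerD ?wB// mulrC wle.
have w'lip s t : s \in `]0, h[%R -> t \in `]0, h[%R -> s <= t ->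
    `|'D_1 w t - 'D_1 w s| <= B / 2.
  rewrite !in_itv/= => /andP[s0 sh] /andP[t0 th] st.
  have I x : s <= x <= t -> x \in `]0, h[%R.
    move=> /andP[sx xt].
    by rewrite in_itv/= (lt_le_trans s0 sx) (le_lt_trans xt th).
  apply: (@le_trans _ _ (K * (1 + h) * B * (t - s))).
    apply: (mean_value_le (u := 'D_1 w)) => //.
      apply: derivable_within_continuous => x; rewrite in_itv/= => xst.
      by have [] := dw' (I x xst).
    move=> x; rewrite in_itv/= => /andP[sx xt].
    have xI : x \in `]0, h[%R by apply: I; rewrite !ltW.
    by split; [have [] := dw' xI|exact: w''le].
  apply: (@le_trans _ _ (K * (1 + h) * B * h)).
    rewrite ler_wpM2l//; last by lra.
    by rewrite !mulr_ge0// addr_ge0// ltW.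
  by have := ler_wpM2l B0 hK; lra.
have w'osc s t : s \in `]0, h[%R -> t \in `]0, h[%R ->
    `|'D_1 w s - 'D_1 w t| <= B / 2.
  move=> sI tI; have [st|/ltW ts] := leP s t; last exact: w'lip.
  by rewrite distrC w'lip.
move=> t tI.
(* v measures the deviation of w from the line of slope w'(t) *)
pose v := w - *:%R^~ ('D_1 w t).
have dl (s : R) : is_derive s 1 ( *:%R^~ ('D_1 w t) : R -> W) ('D_1 w t).
  have [dl dlE] := is_diff_scalel s ('D_1 w t).
  apply: DeriveDef; first exact/derivable1_diffP.
  by rewrite deriveE// dlE scale1r.
have vE s : v s = w s - s *: 'D_1 w t by [].
have : `|v h - v 0| <= B / 2 * (h - 0).
  apply: mean_value_le; first exact: ltW.
    move=> x; apply: cvgB; first exact: cw.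
    have : {within `[0, h], continuous ( *:%R^~ ('D_1 w t) : R -> W)}.
      by apply: continuous_subspaceT; exact: scalel_continuous.
    exact.
  move=> s sI.
  have dvs : is_derive s 1 v ('D_1 w s - 'D_1 w t).
    by apply: is_deriveB; exact/derivableP/dw.
  by split; [case: dvs|rewrite (@derive_val _ _ _ _ _ _ _ dvs) w'osc].
rewrite !vE w0 wh scale0r !subr0 sub0r normrN normrZ gtr0_norm// mulrC.
by rewrite ler_pM2r.
Qed.

(** Iterating the previous bound, |w'| <= B / 2^k for every k. *)
Lemma short_bvp_zero (B : R) :
  (forall t, t \in `]0, h[%R -> `|'D_1 w t| <= B) ->
  forall t, t \in `]0, h[%R -> w t = 0 /\ 'D_1 w t = 0.
Proof.
move=> wB.
have wBk k t : t \in `]0, h[%R -> `|'D_1 w t| <= B / 2 ^+ k.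
  elim: k t => [|k IH] t; first by rewrite expr0 divr1; exact: wB.
  by move=> tI; rewrite exprSr invfM mulrA halve.
have w'0 t : t \in `]0, h[%R -> 'D_1 w t = 0.
  move=> tI; apply/eqP; rewrite -normr_le0 leNgt; apply/negP => w'pos.
  have Bpos : 0 < B by rewrite (lt_le_trans w'pos)// wB.
  have := archi_boundP (ltW (divr_gt0 Bpos w'pos)).
  set N := Num.bound _ => BN.
  have := wBk N t tI; rewrite leNgt => /negP; apply.
  rewrite ltr_pdivrMr ?exprn_gt0// mulrC -ltr_pdivrMr//.
  by rewrite (lt_le_trans BN)// -natrX ler_nat ltnW// ltn_expl.
move=> t tI; split; last exact: w'0.
have /andP[t0 th] : 0 < t < h by move: tI; rewrite in_itv.
apply/eqP; rewrite -normr_le0 -[w t]subr0 -w0 -[leRHS](mul0r (t - 0)).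
apply: mean_value_le; first exact: ltW.
  by apply: continuous_subspaceW cw; apply: subset_itvl; rewrite bnd_simp ltW.
move=> s; rewrite in_itv/= => /andP[s0 st].
have sI : s \in `]0, h[%R by rewrite in_itv/= s0 (lt_trans st).
by split; [exact: dw|rewrite w'0// normr0].
Qed.
End ShortBVP.

(** * Jets of the Euler-Lagrange field *)

Section Jets.
Variables (R : realType) (n : nat).
Local Notation V := 'rV[R]_n.
Implicit Types (Q : set V) (f : V * V * R -> V).

(** The Euler-Lagrange equation as a first order field on extended phase space;
    [total_derivative f] is the derivative along this field. *)
Definition el_field f (x : V * V * R) : V * V * R := (x.1.2, f x, 1).

Lemma open_TQ Q : open Q -> open (TQ Q).
Proof. exact: open_cylinder. Qed.

Lemma has_frame_extended : has_frame (V * V * R)%type.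
Proof.
apply: has_frame_prod (has_frame_R R).
exact: has_frame_prod (has_frame_rV R n) (has_frame_rV R n).
Qed.

Lemma derive_position (x w : V * V * R) :
  'D_w (fun y : V * V * R => y.1.1) x = w.1.1.
Proof.
pose l : {linear (V * V * R)%type -> V} := @fst V V \o @fst (V * V) R.
have cl : continuous l.
  by move=> z; apply: continuous_comp; exact: cvg_fst.
rewrite -[LHS]/('D_w l x) deriveE; last exact: linear_differentiable.
by rewrite diff_lin.
Qed.

Lemma derive_velocity (x w : V * V * R) :
  'D_w (fun y : V * V * R => y.1.2) x = w.1.2.
Proof.
pose l : {linear (V * V * R)%type -> V} := @snd V V \o @fst (V * V) R.
have cl : continuous l.
  by move=> z; apply: continuous_comp; [exact: cvg_fst|exact: cvg_snd].
rewrite -[LHS]/('D_w l x) deriveE; last exact: linear_differentiable.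
by rewrite diff_lin.
Qed.

Lemma Ck_position k (A : set (V * V * R)) :
  open A -> Ck k A (fun y : V * V * R => y.1.1).
Proof.
move=> oA; pose l : {linear (V * V * R)%type -> V} := @fst V V \o @fst (V * V) R.
apply: (Ck_linear (l := l)) => // z.
by apply: continuous_comp; exact: cvg_fst.
Qed.

Lemma Ck_velocity k (A : set (V * V * R)) :
  open A -> Ck k A (fun y : V * V * R => y.1.2).
Proof.
move=> oA; pose l : {linear (V * V * R)%type -> V} := @snd V V \o @fst (V * V) R.
apply: (Ck_linear (l := l)) => // z.
by apply: continuous_comp; [exact: cvg_fst|exact: cvg_snd].
Qed.

Lemma Ck_el_field k (A : set (V * V * R)) f :
  open A -> Ck k A f -> Ck k A (el_field f).
Proof.
move=> oA Cf; apply: Ck_pair => //; last exact: Ck_cst.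
by apply: Ck_pair => //; exact: Ck_velocity.
Qed.

(** The recursion of [el_jet] starts at f, its third term; but the derivative of
    the position along the field is the velocity, and that of the velocity is f.
    So the jets are the coefficients of [taylor_along] for the position. *)
Lemma el_jetE f k :
  el_jet f k = iter k (@lie _ _ (el_field f) _) (fun x : V * V * R => x.1.1).
Proof.
have E1 : lie (el_field f) (fun x : V * V * R => x.1.1) = fun x => x.1.2.
  by apply/funext => x; exact: derive_position.
have E2 : lie (el_field f) (fun x : V * V * R => x.1.2) = f.
  by apply/funext => x; exact: derive_velocity.
by case: k => [|[|k]] //; rewrite !iterSr ?E1 ?E2.
Qed.

Lemma el_jetSE f k :
  el_jet f k.+1 = iter k (@lie _ _ (el_field f) _) (fun x : V * V * R => x.1.2).
Proof.
rewrite el_jetE iterSr; congr iter; apply/funext => x; exact: derive_position.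
Qed.

Lemma taylor_method_pos f rho t (x : V * V) :
  (taylor_method f rho t x).1 = taylor_sum rho.+1 (fun k => el_jet f k (x, 0)) t.
Proof. by []. Qed.

Lemma taylor_method_vel f rho t (x : V * V) :
  (taylor_method f rho t x).2 =
  taylor_sum rho.+1 (fun k => el_jet f k.+1 (x, 0)) t.
Proof. by rewrite /taylor_method /taylor_sum /= big_add1. Qed.

Lemma Ck_el_jet p k (A : set (V * V * R)) f : open A ->
  Ck (k + p) A f -> Ck p A (el_jet f k).
Proof.
move=> oA Cf; rewrite el_jetE; apply: Ck_iter_lie => //.
- exact: has_frame_extended.
- exact: Ck_el_field.
- exact: Ck_position.
Qed.

Lemma C2_curve_derivable Q (a b : R) q t : C2_curve Q a b q -> t \in `]a, b[%R ->
  derivable q t 1 /\ derivable q^`() t 1.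
Proof.
move=> [[dq Dq] _] tI; split; first exact/derivable1_diffP/dq.
have -> : q^`() = 'D_1 q by apply/funext => s; rewrite derive1E.
by have [dDq _] := Dq 1; apply/derivable1_diffP/dDq.
Qed.

(** All that is used of the flow: through (q0, v0) passes an integral curve of
    [el_field], defined on both sides of 0. *)
Lemma el_flow_curve Q (L : V * V -> R) f (Phi : R -> V * V -> V * V)
    (q0 v0 : V) :
  el_normal_form Q L f -> el_flow Q L Phi -> TQ Q (q0, v0) ->
  let q t := (Phi t (q0, v0)).1 in
  let y t := (q t, q^`() t, t) in
  exists2 T : R, 0 < T & y 0 = (q0, v0, 0) /\
    forall t, t \in `]-T, T[%R ->
      [/\ Q (q t), is_derive t 1 q (q^`() t),
          is_derive t 1 q^`() (f (y t)) & is_derive t 1 y (el_field f (y t))].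
Proof.
move=> nf fl x0 q y; have [Phi0 [T T0 [[C2q ELq] Phiq]]] := fl _ x0.
exists T; [exact: T0|split].
  have z : 0 \in `]-T, T[%R by rewrite in_itv/= oppr_lt0 T0.
  have xq : tangent_lift q 0 = (q0, v0) by rewrite -(Phiq _ z).
  by rewrite /y -[(q 0, _)]/(tangent_lift q 0) xq.
have q'' := (nf _ _ _ C2q).1 ELq.
move=> t tI; have [dq dq'] := C2_curve_derivable C2q tI.
have Dq : is_derive t 1 q (q^`() t) by exact: DeriveDef dq (esym (derive1E q t)).
have Dq' : is_derive t 1 q^`() (f (y t)).
  have <- : q^`(2) t = f (y t) by exact: q''.
  exact: DeriveDef dq' (esym (derive1E q^`() t)).
split=> //; first by case: C2q => _; exact.
have /derivable1_diffP ddq := dq.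
have /derivable1_diffP ddq' := dq'.
have didt : differentiable (@id R) t by [].
have dqq : differentiable (fun s => (q s, q^`() s)) t by exact: differentiable_pair.
have dy : differentiable y t by exact: differentiable_pair.
apply: DeriveDef; first exact/derivable1_diffP.
rewrite /y derive_pair// derive_pair// derive_id.
by rewrite (@derive_val _ _ _ _ _ _ _ Dq) (@derive_val _ _ _ _ _ _ _ Dq').
Qed.

End Jets.

(** * Estimates on boxes and on Taylor sums *)

Section Boxes.
Variables (R : realType) (n : nat).
Local Notation V := 'rV[R]_n.

Definition box (x : V) (r : R) : set V := [set z | `|z - x| <= r].

Lemma compact_box (x : V) (r : R) : compact (box x r).
Proof.
apply: bounded_closed_compact.
  exists (r + `|x|); split=> [|M rM z zx]; first exact: num_real.
  rewrite /= -(subrK x z) (le_trans (ler_normD _ _))//.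
  by rewrite (le_trans _ (ltW rM))// lerD2r.
have -> : box x r = (fun z => `|z - x|) @^-1` [set t : R | t <= r] by [].
apply: preimage_closed; last exact: (@closed_le R r).
have cx : continuous (fun z : V => z - x).
  by move=> z; apply: (@cvgB _ _ _ (nbhs z)); [exact: cvg_id|exact: cvg_cst].
by move=> z _; exact: cvg_norm (cx z).
Qed.

Lemma segment_box (x a b : V) (r t : R) : box x r a -> box x r b ->
  0 <= t <= 1 -> box x r (a + t *: (b - a)).
Proof.
rewrite /box /= => ax bx /andP[t0 t1].
have -> : a + t *: (b - a) - x = (1 - t) *: (a - x) + t *: (b - x).
  by apply/matrixP => i j; rewrite !mxE; ring.
rewrite (le_trans (ler_normD _ _))// !normrZ !ger0_norm ?subr_ge0//.
have := ler_wpM2l t0 bx; have t1' : 0 <= 1 - t by rewrite subr_ge0.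
have := ler_wpM2l t1' ax; lra.
Qed.

(** The velocities range over a ball of arbitrary radius D, so a local Lipschitz
    constant would not do: compactness of the ball is needed. *)
Lemma C1_lipschitz_box (Q : set V) (q0 v0 : V) (rho D : R)
    (G : V * V * R -> V) :
  Ck 1 (TQ Q `*` setT) G -> box q0 rho `<=` Q ->
  exists2 C, 0 <= C & forall a b c d t,
    box q0 rho a -> box q0 rho b -> box v0 D c -> box v0 D d -> 0 <= t <= 1 ->
    `|G (a, c, t) - G (b, d, t)| <= C * (`|a - b| + `|c - d|).
Proof.
move=> CG QB.
pose K : set (V * V * R) := (box q0 rho `*` box v0 D) `*` (`[0, 1] : set R).
have [] := C1_lipschitz (K := K) (has_frame_extended R n) CG.
- by apply: compact_setX; [apply: compact_setX; exact: compact_box|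
    exact: segment_compact].
- by move=> [[a c] t] [[/= /QB Qa _] _]; do !split.
- move=> [[a c] s] [[b d] s'] t [[/= a0 c0] s01] [[/= b0 d0] s'01] t01.
  split; first by split; exact: segment_box.
  move: s01 s'01 t01; rewrite /= !in_itv/= => /andP[s0 s1] /andP[s'0 s'1].
  rewrite -[_ *: _]/(_ * _) => /andP[t0 t1].
  have := mulr_ge0 t0 s'0; have := ler_wpM2l t0 s'1.
  have t1' : 0 <= 1 - t by rewrite subr_ge0.
  have := mulr_ge0 t1' s0; have := ler_wpM2l t1' s1; move=> *.
  by apply/andP; split; lra.
move=> C C0 H; exists C => // a b c d t a0 b0 c0 d0 t01.
apply: (le_trans (H (b, d, t) (a, c, t) _ _)).
- by split=> //=; rewrite in_itv.
- by split=> //=; rewrite in_itv.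
rewrite ler_wpM2l//.
rewrite [leLHS]prod_normE/= [X in Num.max X _]prod_normE/= subrr normr0.
by rewrite !ge_max addr_ge0// lerDl lerDr !normr_ge0.
Qed.
End Boxes.

Section TaylorSumDiff.
Variables (R : realType) (W : normedModType R).

Lemma taylor_weight_le (j : nat) (t : R) : 0 <= t -> t ^+ j / j`!%:R <= t ^+ j.
Proof.
move=> t0; rewrite ler_pdivrMr ?ltr0n ?fact_gt0// ler_peMr ?exprn_ge0//.
by rewrite ler1n fact_gt0.
Qed.

Lemma taylor_sum_diff k (a b : nat -> W) (t N : R) : 0 <= t <= 1 ->
  (forall j, (j < k)%N -> `|a j - b j| <= N) ->
  `|taylor_sum k a t - taylor_sum k b t| <= k%:R * N.
Proof.
move=> /andP[t0 t1] abN; rewrite /taylor_sum -sumrB.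
rewrite (le_trans (ler_norm_sum _ _ _))//.
rewrite (_ : k%:R * N = \sum_(0 <= j < k) N); last first.
  by rewrite sumr_const_nat subn0 mulr_natl.
apply: ler_sum_nat => j /andP[_ jk].
rewrite -scalerBr normrZ ger0_norm ?divr_ge0 ?exprn_ge0//.
rewrite -[N]mul1r ler_pM ?divr_ge0 ?exprn_ge0// ?abN//.
by rewrite (le_trans (taylor_weight_le _ t0))// exprn_ile1.
Qed.

(** The terms of degree at least 2 carry a factor t^2; after division by t they
    are absorbed, for small t, by the term of degree 1. *)
Lemma taylor_sum_diff_tail k (a b : nat -> W) (t N : R) : 0 <= t <= 1 ->
  a 0%N = b 0%N -> (forall j, (j < k.+2)%N -> `|a j - b j| <= N) ->
  `|taylor_sum k.+2 a t - taylor_sum k.+2 b t - t *: (a 1%N - b 1%N)|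
    <= t ^+ 2 * (k%:R * N).
Proof.
move=> /andP[t0 t1] ab0 abN.
rewrite /taylor_sum -sumrB 2?big_nat_recl// ab0 subrr add0r.
rewrite expr1 divr1 -scalerBr addrAC subrr add0r.
rewrite (le_trans (ler_norm_sum _ _ _))//.
rewrite (_ : t ^+ 2 * (k%:R * N) = \sum_(0 <= j < k) (t ^+ 2 * N)); last first.
  by rewrite sumr_const_nat subn0 mulrCA mulr_natl.
apply: ler_sum_nat => j /andP[_ jk].
rewrite -scalerBr normrZ ger0_norm ?divr_ge0 ?exprn_ge0//.
rewrite ler_pM ?divr_ge0 ?exprn_ge0// ?abN//.
rewrite (le_trans (taylor_weight_le _ t0))//.
by rewrite -addn2 exprD ler_piMl ?exprn_ge0// exprn_ile1.
Qed.
End TaylorSumDiff.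

(** * Error estimates along the flow *)

Section AlongTheFlow.
Variables (R : realType) (n : nat) (Q : set 'rV[R]_n).
Local Notation V := 'rV[R]_n.
Variables (f : V * V * R -> V) (q : R -> V) (T : R) (q0 v0 : V) (r : nat).
Hypothesis oQ : open Q.
Hypothesis Cf : Ck r.+2 (TQ Q `*` setT) f.
Hypothesis T0 : 0 < T.
Let y t : V * V * R := (q t, derive1 q t, t).
Hypothesis y0 : y 0 = (q0, v0, 0).
Hypothesis flow : forall t, t \in `]-T, T[%R ->
  [/\ Q (q t), is_derive t 1 q (derive1 q t),
      is_derive t 1 (derive1 q) (f (y t)) & is_derive t 1 y (el_field f (y t))].

Let inT t : 0 <= t < T -> t \in `]-T, T[%R.
Proof.
by move=> /andP[t0 tT]; rewrite in_itv/= tT andbT (lt_le_trans _ t0)// oppr_lt0.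
Qed.

Let q0E : q 0 = q0. Proof. by case: y0. Qed.
Let v0E : derive1 q 0 = v0. Proof. by case: y0. Qed.

Let zT : 0 \in `]-T, T[%R. Proof. by apply: inT; rewrite lexx. Qed.

Lemma flow_continuous : {for 0, continuous q} /\ {for 0, continuous (derive1 q)}.
Proof.
have [_ [dq _] [dq' _] _] := flow zT.
split; first exact: (differentiable_continuous ((derivable1_diffP q 0).1 dq)).
exact: (differentiable_continuous ((derivable1_diffP (derive1 q) 0).1 dq')).
Qed.

Lemma flow_near (e : R) : 0 < e -> exists2 eta : R, 0 < eta < T &
  forall t, 0 <= t <= eta -> box q0 e (q t) /\ box v0 e (derive1 q t).
Proof.
move=> e0; have [cq cq'] := flow_continuous.
have /cvgrPdist_lt/(_ e e0)[d1 /= d10 H1] := cq.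
have /cvgrPdist_lt/(_ e e0)[d2 /= d20 H2] := cq'.
pose eta := Num.min (Num.min (d1 / 2) (d2 / 2)) (T / 2).
have half (a : R) : 0 < a -> a / 2 < a by move=> ?; lra.
exists eta.
  by rewrite !lt_min !divr_gt0//= !gt_min (half T)// !orbT.
move=> t /andP[t0]; rewrite !le_min => /andP[/andP[t1 t2] _].
rewrite /box /= -q0E -v0E distrC [X in _ /\ is_true (X <= _)]distrC.
split; apply/ltW; [apply: H1|apply: H2]; rewrite /= sub0r normrN ger0_norm//.
  by rewrite (le_lt_trans t1)// half.
by rewrite (le_lt_trans t2)// half.
Qed.

Lemma box_sub : exists2 rho : R, 0 < rho & box q0 rho `<=` Q.
Proof.
have Qq0 : Q q0 by rewrite -q0E; have [] := flow zT.
have /nbhs_ballP[e /= e0 eQ] := open_nbhs_nbhs (conj oQ Qq0).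
exists (e / 2); first exact: divr_gt0.
move=> z zq0; apply: eQ; rewrite -ball_normE /= distrC (le_lt_trans zq0)//.
by lra.
Qed.

(** The bound D on the velocity, together with p 0 = q0, keeps a solution p on a
    short interval inside a box on which f is Lipschitz; the flow curve stays
    there too, and [short_bvp_zero] applies to the difference. *)
Lemma bvp_is_flow (D : R) : exists2 eta : R, 0 < eta < T &
  forall h p, 0 < h <= eta ->
    C2_curve Q 0 h p ->
    (forall t, t \in `]0, h[%R -> derive1n 2 p t = f (tangent_lift p t, t)) ->
    {within `[0, h], continuous p} -> p 0 = q0 -> p h = q h ->
    (forall t, t \in `]0, h[%R -> `|derive1 p t - v0| < D) ->
    forall t, t \in `]0, h[%R -> tangent_lift p t = tangent_lift q t.
Proof.
have [rho rho0 rhoQ] := box_sub.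
pose D' := Num.max D 1.
have D'0 : 0 < D' by rewrite lt_max ltr01 orbT.
have Cf1 : Ck 1 (TQ Q `*` setT) f by apply: Ck_le Cf.
have [K K0 fK] := C1_lipschitz_box v0 D' Cf1 rhoQ.
have e0 : 0 < Num.min rho 1 by rewrite lt_min rho0 ltr01.
have [eta1 /andP[eta10 eta1T] qnear] := flow_near e0.
pose S := `|v0| + D'.
have S0 : 0 < S by rewrite ltr_wpDl.
(* eta2 keeps p in the ball of radius rho and makes K (1 + h) h <= 1 / 2 *)
pose eta2 := Num.min 1 (Num.min (rho / S) (4 * (K + 1))^-1).
have eta20 : 0 < eta2.
  by rewrite !lt_min ltr01 divr_gt0//= invr_gt0 mulr_gt0// ltr_wpDl.
exists (Num.min eta1 eta2).
  by rewrite lt_min eta10 eta20 gt_min eta1T.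
move=> h p /andP[h0]; rewrite le_min => /andP[h1].
rewrite !le_min => /andP[hle1 /andP[hrho hK]] C2p p'' cp p0 ph pD.
have hS : S * h <= rho by rewrite mulrC -ler_pdivlMr.
have hK' : K * (1 + h) * h <= 1 / 2.
  have K1 : 0 < 4 * (K + 1) by rewrite mulr_gt0// ltr_wpDl.
  have : h * (4 * (K + 1)) <= 1 by rewrite -ler_pdivlMr// div1r.
  have := mulr_ge0 K0 (ltW h0).
  have : K * h * h <= K * h by rewrite ler_piMr// mulr_ge0// ltW.
  by move=> *; lra.
have inh t : t \in `]0, h[%R -> t \in `]-T, T[%R.
  rewrite in_itv/= => /andP[t0 th]; apply: inT.
  by rewrite ltW//= (lt_trans th)// (le_lt_trans h1).
have in01 t : t \in `]0, h[%R -> 0 <= t <= 1.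
  rewrite in_itv/= => /andP[t0 th]; apply/andP; split; first exact: ltW.
  by rewrite (le_trans (ltW th)).
have dp t : t \in `]0, h[%R -> is_derive t 1 p (derive1 p t) /\
    is_derive t 1 (derive1 p) (f (tangent_lift p t, t)).
  move=> tI; have [dp dp'] := C2_curve_derivable C2p tI.
  split; first exact: DeriveDef dp (esym (derive1E p t)).
  exact: DeriveDef dp' (etrans (esym (derive1E (derive1 p) t)) (p'' t tI)).
have pbox t : t \in `]0, h[%R -> box q0 rho (p t) /\ box v0 D' (derive1 p t).
  move=> tI; have /andP[t0 th] : 0 < t < h by move: tI; rewrite in_itv.
  have vbox s : s \in `]0, h[%R -> box v0 D' (derive1 p s).
    by move=> sI; rewrite /box /= le_max ltW// pD.
  split; last exact: vbox.
  rewrite /box /= -p0 (@le_trans _ _ (S * (t - 0)))//.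
    apply: mean_value_le; first exact: ltW.
      by apply: continuous_subspaceW cp; apply: subset_itvl; rewrite bnd_simp ltW.
    move=> s; rewrite in_itv/= => /andP[s0 st].
    have sI : s \in `]0, h[%R by rewrite in_itv/= s0 (lt_trans st).
    have [[dps ->] _] := dp s sI; split=> //.
    rewrite -(subrK v0 (derive1 p s)) addrC (le_trans (ler_normD _ _))// lerD2l.
    exact: vbox.
  by rewrite subr0 (le_trans _ hS)// ler_wpM2l// ltW.
have qbox t : t \in `]0, h[%R -> box q0 rho (q t) /\ box v0 D' (derive1 q t).
  rewrite in_itv/= => /andP[t0 th].
  have [|] := qnear t; first by rewrite ltW//= (le_trans (ltW th)).
  rewrite /box /= !le_min => /andP[-> _] /andP[_ q'1]; split=> //.
  by rewrite le_max q'1 orbT.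
pose w := p - q.
have Dw t : t \in `]0, h[%R -> is_derive t 1 w (derive1 p t - derive1 q t).
  move=> tI; have [dpt _] := dp t tI; have [_ dqt _ _] := flow (inh t tI).
  exact: is_deriveB.
have Dw' t : t \in `]0, h[%R -> is_derive t 1 ('D_1 w)
    (f (tangent_lift p t, t) - f (y t)).
  move=> tI; have [_ dpt] := dp t tI; have [_ _ dqt _] := flow (inh t tI).
  have near_w' : \forall s \near t, (derive1 p - derive1 q) s = 'D_1 w s.
    near=> s; have sI : s \in `]0, h[%R.
      by near: s; exact: near_in_itvoo.
    by rewrite (@derive_val _ _ _ _ _ _ _ (Dw s sI)).
  by apply: near_eq_is_derive near_w' _; exact: is_deriveB.
have cw : {within `[0, h], continuous w}.
  move=> x; apply: cvgB; first exact: cp.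
  have cq : {within `[0, h], continuous q}.
    apply: derivable_within_continuous => s; rewrite in_itv/= => /andP[s0 sh].
    have [|_ [dqs _] _ _] := flow (t := s); last exact: dqs.
    by apply: inT; rewrite s0/= (le_lt_trans sh)// (le_lt_trans h1).
  exact: cq.
have w0 : w 0 = 0 by rewrite /w -[LHS]/(_ - _) p0 q0E subrr.
have wh : w h = 0 by rewrite /w -[LHS]/(_ - _) ph subrr.
have dw s : s \in `]0, h[%R -> derivable w s 1 by move=> /Dw [].
have dw' s : s \in `]0, h[%R -> derivable ('D_1 w) s 1 /\
    `|'D_1 ('D_1 w) s| <= K * (`|w s| + `|'D_1 w s|).
  move=> sI; have [dws' ->] := Dw' s sI; have [_ ->] := Dw s sI; split=> //.
  have [[pb pb'] [qb qb']] := (pbox s sI, qbox s sI).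
  exact: fK (in01 s sI).
have w'le s : s \in `]0, h[%R -> `|'D_1 w s| <= D' + D'.
  move=> sI; have [_ ->] := Dw s sI.
  have [[_ pb'] [_ qb']] := (pbox s sI, qbox s sI).
  have -> : derive1 p s - derive1 q s = (derive1 p s - v0) - (derive1 q s - v0).
    by rewrite opprB addrA subrK.
  exact: le_trans (ler_normB _ _) (lerD pb' qb').
move=> t tI; have [wt w't] := short_bvp_zero h0 K0 hK' cw w0 wh dw dw' w'le tI.
move: w't; have [_ ->] := Dw t tI => /eqP; rewrite subr_eq0 => /eqP p'q'.
have /eqP : p t - q t = 0 by exact: wt.
by rewrite subr_eq0 /tangent_lift p'q' => /eqP ->.
Unshelve. all: by end_near. Qed.

Let Om := TQ Q `*` (setT : set R).
Let oOm : open Om. Proof. exact/open_cylinder/open_TQ. Qed.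

(** A jet of order k <= r+1 involves at most r-1 derivatives of f along the field,
    so all of them are C^1; they are compared on the convex set of the points
    (q0, v, 0) with v in a ball containing v0. *)
Lemma jets_lipschitz (D : R) : exists2 M : R, 0 <= M &
  forall k v, (k < r.+2)%N -> box v0 D v ->
    `|el_jet f k (q0, v, 0) - el_jet f k (q0, v0, 0)| <= M * `|v - v0|.
Proof.
have [rho rho0 rhoQ] := box_sub.
pose D' := Num.max D 0.
have [M MP] : {M : 'I_r.+2 -> R & forall k, 0 <= M k /\ forall v, box v0 D v ->
    `|el_jet f k (q0, v, 0) - el_jet f k (q0, v0, 0)| <= M k * `|v - v0|}.
  apply: (@choice 'I_r.+2 R (fun k M => 0 <= M /\ forall v, box v0 D v ->
    `|el_jet f k (q0, v, 0) - el_jet f k (q0, v0, 0)| <= M * `|v - v0|)) => k.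
  have CJ : Ck 1 Om (el_jet f k).
    by apply: Ck_el_jet => //; apply: Ck_le Cf; rewrite addn1.
  have [C C0 CP] := C1_lipschitz_box v0 D' CJ rhoQ.
  exists C; split=> // v vD.
  have -> : `|v - v0| = `|q0 - q0| + `|v - v0| by rewrite subrr normr0 add0r.
  have q0b : box q0 rho q0 by rewrite /box /= subrr normr0 ltW.
  apply: CP; rewrite ?lexx ?ler01//.
    by rewrite /box /= le_max vD.
  by rewrite /box /= subrr normr0 le_max lexx orbT.
exists (\sum_k M k); first by apply: sumr_ge0 => k _; have [] := MP k.
move=> k v kr vD; have [_ /(_ v vD) /le_trans] := MP (Ordinal kr); apply.
rewrite ler_wpM2r// (bigD1 (Ordinal kr))//= lerDl.
by apply: sumr_ge0 => j _; have [] := MP j.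
Qed.

(** The expansion of the position with one more term is the one that matches the
    map of order r+1 defining the approximate velocity. *)
Lemma flow_taylor : exists C : R, exists2 e : R, 0 < e < T & forall t, 0 <= t <= e ->
  [/\ `|q t - taylor_sum r.+2 (fun k => el_jet f k (q0, v0, 0)) t| <= C * t ^+ r.+2,
      `|q t - taylor_sum r.+1 (fun k => el_jet f k (q0, v0, 0)) t| <= C * t ^+ r.+1 &
      `|derive1 q t - taylor_sum r.+1 (fun k => el_jet f k.+1 (q0, v0, 0)) t|
        <= C * t ^+ r.+1].
Proof.
have yOm t : t \in `]-T, T[%R -> Om (y t) by move=> /flow[Qq _ _ _]; split.
have dy t : t \in `]-T, T[%R -> is_derive t 1 y (el_field f (y t)).
  by move=> /flow[].
have CX : Ck r.+2 Om (el_field f) by exact: Ck_el_field.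
have CX' : Ck r.+1 Om (el_field f) := CkW CX.
have fr := has_frame_extended R n.
have [C1 [e1 /andP[e10 e1T] H1]] :=
  taylor_along fr oOm T0 yOm dy CX (Ck_position _ oOm).
have [C2 [e2 /andP[e20 e2T] H2]] :=
  taylor_along fr oOm T0 yOm dy CX' (Ck_position _ oOm).
have [C3 [e3 /andP[e30 e3T] H3]] :=
  taylor_along fr oOm T0 yOm dy CX' (Ck_velocity _ oOm).
exists (Num.max C1 (Num.max C2 C3)).
exists (Num.min e1 (Num.min e2 e3)).
  by rewrite !lt_min e10 e20 e30 gt_min e1T.
move=> t /andP[t0]; rewrite !le_min => /and3P[t1 t2 t3].
have le_tmax (C : R) k x : C <= Num.max C1 (Num.max C2 C3) ->
    x <= C * t ^+ k -> x <= Num.max C1 (Num.max C2 C3) * t ^+ k.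
  by move=> CC /le_trans; apply; rewrite ler_wpM2r// exprn_ge0.
split.
- apply: (le_tmax C1); first by rewrite le_max lexx.
  have := H1 t; rewrite t0 t1 => /(_ isT); congr (`|_ - _| <= _).
  by apply: eq_bigr => j _; rewrite -el_jetE y0.
- apply: (le_tmax C2); first by rewrite !le_max lexx orbT.
  have := H2 t; rewrite t0 t2 => /(_ isT); congr (`|_ - _| <= _).
  by apply: eq_bigr => j _; rewrite -el_jetE y0.
- apply: (le_tmax C3); first by rewrite !le_max lexx !orbT.
  have := H3 t; rewrite t0 t3 => /(_ isT); congr (`|_ - _| <= _).
  by apply: eq_bigr => j _; rewrite -el_jetSE y0.
Qed.

(** Subtracting the expansion of q(h) from the equation satisfied by v leaves
    h |v - v0| <= |C| h^(r+2) + r M h^2 |v - v0|, and for h <= e the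
    last term is at most half of the left-hand side. *)
Lemma velocity_error (D : R) : exists2 C : R, 0 <= C & exists2 e : R, 0 < e < T &
  forall h v, 0 < h <= e -> box v0 D v ->
    q h = taylor_sum r.+2 (fun k => el_jet f k (q0, v, 0)) h ->
    `|v - v0| <= C * h ^+ r.+1.
Proof.
have [M M0 jetM] := jets_lipschitz D.
have [C [e /andP[e0 eT] taylorC]] := flow_taylor.
pose e' := Num.min (Num.min e 1) (2 * (r%:R * M + 1))^-1.
have K0 : 0 < r%:R * M + 1 by rewrite ltr_wpDl ?mulr_ge0.
exists (2 * `|C|); first by rewrite mulr_ge0.
exists e'.
  by rewrite !lt_min e0 ltr01 invr_gt0 mulr_gt0//= !gt_min eT.
move=> h v /andP[h0]; rewrite !le_min => /andP[/andP[he h1] hK] vD qh.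
have [|qh0 _ _] := taylorC h; first by rewrite ltW.
set a := fun k => el_jet f k (q0, v, 0) in qh.
set b := fun k => el_jet f k (q0, v0, 0) in qh0.
have ab : `|taylor_sum r.+2 a h - taylor_sum r.+2 b h - h *: (v - v0)|
    <= h ^+ 2 * (r%:R * (M * `|v - v0|)).
  apply: (@taylor_sum_diff_tail _ _ r a b) => //; first by rewrite ltW.
  by move=> j jr; exact: jetM.
rewrite -qh in ab.
have hv : h * `|v - v0| <= `|C| * h ^+ r.+2 + h ^+ 2 * (r%:R * (M * `|v - v0|)).
  rewrite -[in leLHS](gtr0_norm h0) -normrZ.
  set A := q h - _ in ab qh0.
  have -> : h *: (v - v0) = A - (A - h *: (v - v0)) by rewrite opprB addrCA subrr addr0.
  rewrite (le_trans (ler_normB _ _))// lerD//.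
  rewrite (le_trans qh0)// ler_wpM2r ?exprn_ge0 ?ler_norm//; exact: ltW.
have hK' : h * (2 * (r%:R * M + 1)) <= 1 by rewrite -ler_pdivlMr ?mulr_gt0// div1r.
rewrite -(ler_pM2l h0) mulrCA -exprS.
set d := `|v - v0| in hv *; have d0 : 0 <= d by exact: normr_ge0.
have hd0 : 0 <= h * d by rewrite mulr_ge0// ltW.
have := ler_wpM2l hd0 hK'; rewrite mulr1 => hdK.
rewrite expr2 in hv; have := mulr_ge0 (ltW h0) hd0; lra.
Qed.

(** At a node both the jets, through the initial velocity, and the truncation
    of the Taylor series contribute an error O(h^(r+1)). *)
Lemma node_error (D : R) : exists2 C : R, 0 <= C & exists2 e : R, 0 < e < T &
  forall h v t, 0 < h <= e -> box v0 D v ->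
    q h = (taylor_method f r.+1 h (q0, v)).1 -> 0 <= t <= h ->
    `|(taylor_method f r t (q0, v)).1 - q t| <= C * h ^+ r.+1 /\
    `|(taylor_method f r t (q0, v)).2 - derive1 q t| <= C * h ^+ r.+1.
Proof.
have [M M0 jetM] := jets_lipschitz D.
have [C [e /andP[e0 eT] taylorC]] := flow_taylor.
have [E E0 [e' /andP[e'0 e'T] velE]] := velocity_error D.
exists (r.+1%:R * (M * E) + `|C|); first by rewrite addr_ge0 ?mulr_ge0.
exists (Num.min (Num.min e e') 1).
  by rewrite !lt_min e0 e'0 ltr01 !gt_min eT.
move=> h v t /andP[h0]; rewrite !le_min => /andP[/andP[he he'] h1] vD qh.
move=> /andP[t0 th].
have vv0 : `|v - v0| <= E * h ^+ r.+1.
  by apply: velE => //; rewrite h0.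
have t01 : 0 <= t <= 1 by rewrite t0 (le_trans th).
have [|_ qt q't] := taylorC t; first by rewrite t0 (le_trans th).
have jetle k : (k < r.+2)%N ->
    `|el_jet f k (q0, v, 0) - el_jet f k (q0, v0, 0)| <= M * (E * h ^+ r.+1).
  by move=> kr; rewrite (le_trans (jetM _ _ kr vD))// ler_wpM2l.
have Cth : C * t ^+ r.+1 <= `|C| * h ^+ r.+1.
  rewrite (le_trans (ler_wpM2r (exprn_ge0 _ t0) (ler_norm C)))//.
  by rewrite ler_wpM2l// lerXn2r// nnegrE ?ltW// (le_lt_trans t0).
have combine (a b : nat -> V) (x : V) :
    (forall j, (j < r.+1)%N -> `|a j - b j| <= M * (E * h ^+ r.+1)) ->
    `|x - taylor_sum r.+1 b t| <= C * t ^+ r.+1 ->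
    `|taylor_sum r.+1 a t - x| <= (r.+1%:R * (M * E) + `|C|) * h ^+ r.+1.
  move=> abN xb; rewrite -(subrK (taylor_sum r.+1 b t) (taylor_sum r.+1 a t)) -addrA.
  rewrite (le_trans (ler_normD _ _))// mulrDl lerD//.
    have := taylor_sum_diff t01 abN; rewrite !mulrA; exact.
  by rewrite distrC (le_trans xb).
split.
  by rewrite taylor_method_pos; apply: combine qt => j jr; apply/jetle/ltnW.
by rewrite taylor_method_vel; apply: combine q't => j jr; exact: jetle.
Qed.

End AlongTheFlow.

(** * Order of the Taylor discrete Lagrangian *)

(** [taylor_along] for L, lifted to extended phase space, in the form asked for by
    [quadrature_estimate]; one more degree of smoothness of L makes the function
    differentiable, hence continuous, along the curve. *)
Lemma lagrangian_taylor (R : realType) (n : nat) (Q : set 'rV[R]_n)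
    (f : 'rV[R]_n * 'rV[R]_n * R -> 'rV[R]_n) (L : 'rV[R]_n * 'rV[R]_n -> R)
    (q : R -> 'rV[R]_n) (T : R) (s : nat) :
  let y t := (q t, derive1 q t, t) in
  open Q -> 0 < T ->
  (forall t, t \in `]-T, T[%R -> Q (q t)) ->
  (forall t, t \in `]-T, T[%R -> is_derive t 1 y (el_field f (y t))) ->
  Ck s (TQ Q `*` setT) f -> Ck s.+1 (TQ Q) L ->
  exists (p : {poly R}) (C e : R), [/\ 0 < e,
    {within `[0, e], continuous (fun t => L (tangent_lift q t))} &
    forall t, 0 <= t <= e -> `|L (tangent_lift q t) - p.[t]| <= C * t ^+ s].
Proof.
move=> y oQ T0 Qq dy Cf CL.
pose A := TQ Q `*` (setT : set R).
have oA : open A by exact/open_cylinder/open_TQ.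
have yA t : t \in `]-T, T[%R -> A (y t) by move=> /Qq.
pose G (x : 'rV[R]_n * 'rV[R]_n * R) := L x.1.
have CG : Ck s.+1 A G by exact: Ck_fst.
have [C [e /andP[e0 eT] GC]] :=
  taylor_along (has_frame_extended R n) oA T0 yA dy (Ck_el_field oA Cf) (CkW CG).
exists (\poly_(j < s) (iter j (@lie _ _ (el_field f) _) G (y 0) / j`!%:R)), C, e.
split=> //; last first.
  by move=> t te; rewrite -taylor_sum_horner; exact: GC.
apply: derivable_within_continuous => t; rewrite in_itv/= => /andP[t0 te].
have tT : t \in `]-T, T[%R.
  by rewrite in_itv/= (lt_le_trans _ t0) ?oppr_lt0//= (le_lt_trans te).
have [dG _] := CG.
by have [] := is_derive_along dy tT (dG _ (yA t tT)).
Qed.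

Unset Implicit Arguments.

Theorem theorem1 (R : realType) (n : nat) (Q : set 'rV[R]_n)
    (L : 'rV[R]_n * 'rV[R]_n -> R)
    (f : 'rV[R]_n * 'rV[R]_n * R -> 'rV[R]_n)
    (Phi : R -> 'rV[R]_n * 'rV[R]_n -> 'rV[R]_n * 'rV[R]_n)
    (r s m : nat) (b c : 'I_m -> R) (use_q1 : bool)
    (vel : 'rV[R]_n -> 'rV[R]_n -> R -> 'rV[R]_n)
    (bvp : 'rV[R]_n -> 'rV[R]_n -> R -> R -> 'rV[R]_n)
    (q0 v0 : 'rV[R]_n) (delta : R) :
  open Q ->
  Ck (maxn r s).+2 (TQ Q) L ->
  Ck (maxn r s).+2 (TQ Q `*` setT) f ->
  (exists K : R, K.-lipschitz_(TQ Q) L) ->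
  el_normal_form Q L f ->
  el_flow Q L Phi ->
  quadrature_order b c s ->
  TQ Q (q0, v0) ->
  (\forall h \near 0^'+,
     let q1 := (Phi h (q0, v0)).1 in
     inverse_solution f r q0 q1 h (vel q0 q1 h) /\
     `|vel q0 q1 h - v0| < delta) ->
  (\forall h \near 0^'+,
     let q1 := (Phi h (q0, v0)).1 in
     bvp_solution Q L q0 q1 h (bvp q0 q1 h) /\
     (forall t, t \in `]0, h[%R -> `|derive1 (bvp q0 q1 h) t - v0| < delta)) ->
  (fun h : R =>
     let q1 := (Phi h (q0, v0)).1 in
     taylor_discrete_lagrangian L f r b c use_q1 vel q0 q1 h
     - exact_discrete_lagrangian L bvp q0 q1 h)
    =O_ (0^'+) (fun h : R => h ^+ (minn r.+1 s).+1).
Proof.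
move=> oQ CL Cf [K LK] nf fl quad x0 vel_near bvp_near.
pose q t := (Phi t (q0, v0)).1.
have Cfr : Ck r.+2 (TQ Q `*` setT) f by apply: Ck_le Cf; rewrite !ltnS leq_maxl.
have [T T0 [y0 flow]] := el_flow_curve nf fl x0.
rewrite -/q in y0 flow.
have [rho rho0 rhoQ] := box_sub oQ T0 y0 flow.
have [eta1 /andP[eta10 _] bvpP] := bvp_is_flow oQ Cfr T0 y0 flow delta.
have [C C0 [eta2 /andP[eta20 _] nodeP]] := node_error oQ Cfr T0 y0 flow delta.
have [eta3 /andP[eta30 _] nearP] := flow_near T0 y0 flow (divr_gt0 rho0 (ltr0Sn _ 1)).
pose g t := L (tangent_lift q t).
have [p [C' [e [e0 cg gC']]]] : exists (p : {poly R}) (C e : R), [/\ 0 < e,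
    {within `[0, e], continuous g} &
    forall t, 0 <= t <= e -> `|g t - p.[t]| <= C * t ^+ s].
  have sN : (s <= maxn r s)%N by exact: leq_maxr.
  apply: (lagrangian_taylor oQ T0 (f := f)).
  - by move=> t /flow[].
  - by move=> t /flow[].
  - by apply: Ck_le Cf; exact: leqW (leqW sN).
  - by apply: Ck_le CL; exact: leqW.
have [C'' C''0 quadP] : exists2 C'' : R, 0 <= C'' & \forall h \near 0^'+,
    `|h * (\sum_(i < m) b i * g (c i * h)) - \int[lebesgue_measure]_(t in `[0, h]) g t|
      <= C'' * h ^+ s.+1.
  exact: quadrature_estimate quad e0 cg gC'.
have c01 : forall i, 0 <= c i <= 1 by case: quad.
pose B := \sum_(i < m) `|b i|.
have B0 : 0 <= B by exact: sumr_ge0.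
apply/eqO_exP; exists (B * (`|K| * C) + C'' + 1).
  by rewrite ltr_wpDl// addr_ge0// !mulr_ge0.
near=> h.
have h0 : 0 < h by near: h; exact: nbhs_right_gt.
have h1 : h <= 1 by near: h; exact: nbhs_right_le.
have he : h <= e by near: h; exact: nbhs_right_le.
have heta1 : h <= eta1 by near: h; exact: nbhs_right_le.
have heta2 : h <= eta2 by near: h; exact: nbhs_right_le.
have heta3 : h <= eta3 by near: h; exact: nbhs_right_le.
(* this bound on h keeps the positions at the nodes in Q *)
have hC : h <= rho / 2 / (C + 1).
  by near: h; apply: nbhs_right_le; rewrite !divr_gt0// ltr_wpDl.
have [inv_h vel_h] : inverse_solution f r q0 (q h) h (vel q0 (q h) h) /\
  `|vel q0 (q h) h - v0| < delta by near: h.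
have [[[C2p ELp] cp p0 ph] p_h] :
  bvp_solution Q L q0 (q h) h (bvp q0 (q h) h) /\
  (forall t, t \in `]0, h[%R -> `|derive1 (bvp q0 (q h) h) t - v0| < delta).
  by near: h.
have quad_h : `|h * (\sum_(i < m) b i * g (c i * h)) -
  \int[lebesgue_measure]_(t in `[0, h]) g t| <= C'' * h ^+ s.+1 by near: h.
rewrite -/(q h) /=.
have p'' := (nf _ _ _ C2p).1 ELp.
(* the exact discrete Lagrangian is computed along the flow *)
have pq : forall t, t \in `]0, h[%R ->
    tangent_lift (bvp q0 (q h) h) t = tangent_lift q t.
  by apply: bvpP => //; rewrite h0.
have -> : exact_discrete_lagrangian L bvp q0 (q h) h =
    \int[lebesgue_measure]_(t in `[0, h]) g t.
  apply: eq_Rintegral_oo => [|t tI]; last by rewrite /g -pq.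
  by apply: continuous_subspaceW cg; apply: subset_itvl; rewrite bnd_simp.
have vel_box : box v0 delta (vel q0 (q h) h) by exact: ltW.
rewrite /taylor_discrete_lagrangian.
set node := fun i : 'I_m => let x := taylor_method f r (c i * h) (q0, vel q0 (q h) h) in
  (if use_q1 && (c i == 1) then q h else x.1, x.2).
have nodeL i : `|L (node i) - g (c i * h)| <= `|K| * (C * h ^+ r.+1).
  have /andP[ci0 ci1] := c01 i.
  have ch0 : 0 <= c i * h by rewrite mulr_ge0// ltW.
  have chh : c i * h <= h by rewrite ler_piMl// ltW.
  have ch : 0 <= c i * h <= h by rewrite ch0.
  have hr1 : C * h ^+ r.+1 <= rho / 2.
    apply: (@le_trans _ _ (C * h)).
      by rewrite ler_wpM2l// exprS ler_piMr ?exprn_ile1// ltW.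
    rewrite (@le_trans _ _ (h * (C + 1)))//; last by rewrite -ler_pdivlMr// ltr_wpDl.
    by rewrite mulrC ler_pM2l// lerDl.
  have [|xp xv] := nodeP h (vel q0 (q h) h) (c i * h) _ vel_box inv_h ch.
    by rewrite h0.
  have Ch0 : 0 <= C * h ^+ r.+1 by rewrite mulr_ge0// exprn_ge0// ltW.
  have node1 : `|(node i).1 - q (c i * h)| <= C * h ^+ r.+1.
    rewrite /node /=; case: ifPn => // /andP[_ /eqP ->].
    by rewrite mul1r subrr normr0.
  have qQ : box q0 (rho / 2) (q (c i * h)).
    by have [|] := nearP (c i * h); first by rewrite ch0 (le_trans chh).
  have nodeQ : TQ Q (node i).
    split=> //; apply: rhoQ; change (`|(node i).1 - q0| <= rho).
    rewrite -(subrK (q (c i * h)) (node i).1) -addrA (le_trans (ler_normD _ _))//.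
    by rewrite [leRHS](splitr rho) lerD// (le_trans node1).
  have qTQ : TQ Q (tangent_lift q (c i * h)).
    split=> //; apply: rhoQ; apply: (le_trans qQ).
    by rewrite ler_pdivrMr// ler_peMr ?ler1n// ltW.
  apply: (le_trans (LK (node i, tangent_lift q (c i * h)) (conj nodeQ qTQ))).
  rewrite (le_trans (ler_wpM2r (normr_ge0 _) (ler_norm K)))// ler_wpM2l//.
  by rewrite [leLHS]prod_normE ge_max node1 xv.
pose S1 := \sum_(i < m) b i * L (node i).
pose S2 := \sum_(i < m) b i * g (c i * h).
have S12 : `|S1 - S2| <= B * (`|K| * (C * h ^+ r.+1)).
  rewrite -sumrB mulr_suml (le_trans (ler_norm_sum _ _ _))//.
  by apply: ler_sum => i _; rewrite -mulrBr normrM ler_wpM2l.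
rewrite -/S1 -/S2 in quad_h *.
set I := \int[lebesgue_measure]_(t in _) _ in quad_h *.
have -> : h * S1 - I = h * (S1 - S2) + (h * S2 - I) by ring.
have hN0 : 0 <= h ^+ (minn r.+1 s).+1 by rewrite exprn_ge0// ltW.
have hpow k : (minn r.+1 s <= k)%N -> h ^+ k.+1 <= h ^+ (minn r.+1 s).+1.
  by move=> kN; rewrite ler_wiXn2l// ltW.
rewrite (le_trans (ler_normD _ _))// normrM (gtr0_norm h0) (ger0_norm hN0).
have := ler_wpM2l (ltW h0) S12.
have BKC0 : 0 <= B * (`|K| * C) by rewrite !mulr_ge0.
have := ler_wpM2l BKC0 (hpow _ (geq_minl r.+1 s)).
have := ler_wpM2l C''0 (hpow _ (geq_minr r.+1 s)).
by rewrite [h ^+ r.+2]exprS; lra.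
Unshelve. all: by end_near. Qed.
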